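(* Let $X$ be a compact Kähler manifold of dimension $n$ with Kähler metric $h$, let $p \in X$, let $\mu : \widehat{X} \to X$ be the blowup of $X$ at $p$ with exceptional divisor $E$, and let $h_t = \mu^* h + t b$ with $t>0$ small enough that $h_t$ is a Kähler metric, where $b$ is the Hermitian form on $\widehat X$ described in the context. Let $q \in E$, and use the local coordinates $(x,y)$ adapted to $q$ (in which $q = (0,0)$ is ''the origin'') and the local frame $\xi_1,\ldots,\xi_n$ of $T_{\widehat X}$ described in the context. Let $\alpha = \sum_{j=1}^n \alpha_j \xi_j$, $\beta = \sum_{k=1}^n \beta_k \xi_k$, $\gamma = \sum_{l=1}^n \gamma_l \xi_l$ and $\delta = \sum_{m=1}^n \delta_m \xi_m$ be holomorphic tangent fields on $\widehat X$ near $(0,0)$. Then the curvature of $h_t$ at the origin is $$ \begin{aligned} R_{h_t}(\alpha, \overline\beta, \gamma, \overline\delta) ={}& H_h(e_n)\, \alpha_n \bar\beta_n \gamma_n \bar\delta_n + t \bigl( \tau(\alpha, \bar\beta)\, \tau(\gamma, \bar\delta) + \tau(\alpha, \bar\delta)\, \tau(\gamma, \bar\beta) \bigr) \\ & - \alpha_n \bar\beta_n\, \tau(\gamma, \bar\delta) - \alpha_n \bar\delta_n\, \tau(\gamma, \bar\beta) - \gamma_n \bar\beta_n\, \tau(\alpha, \bar\delta) - \gamma_n \bar\delta_n\, \tau(\alpha, \bar\beta). \end{aligned} $$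
   Context: Curvature conventions. For a Kähler metric $g$ with coefficients $g_{j\bar k} = g(\partial_j, \overline{\partial_k})$ in local holomorphic coordinates, the curvature tensor $R_g(\alpha,\overline\beta,\gamma,\overline\delta)$ of its Chern connection is normalized by $R_{j\bar k l\bar m} = -\partial_j \partial_{\bar k} g_{l\bar m} + \sum_{a,b} g^{a \bar b}\, \partial_j g_{l\bar b}\, \partial_{\bar k} g_{a\bar m}$. The holomorphic sectional curvature is $H_g(\xi) = R_g(\xi,\overline\xi,\xi,\overline\xi)/|\xi|_g^4$ for $\xi \neq 0$. The Hermitian form associated to a real $(1,1)$-form $\frac{i}{2}\sum b_{j\bar k}\, dz_j\wedge d\bar z_k$ is the one with coefficients $b_{j\bar k}$. With these conventions the Fubini–Study metric given by $\frac i2 \partial\bar\partial \log|v|^2$ has constant holomorphic sectional curvature $2$. The form $b$. Fix holomorphic coordinates $z=(z_1,\ldots,z_n)$ centered at $p$ that are normal for $h$, i.e. $h(\partial/\partial z_j, \overline{\partial/\partial z_k}) = \delta_{jk} + O(|z|^2)$. They identify a neighborhood of $E$ in $\widehat X$ with a neighborhood of the exceptional divisor $\{0\} \times \mathbf P(\mathbf C^n)$ in $\{(v,[w]) \in \mathbf C^n \times \mathbf P(\mathbf C^n) \mid v \in \mathbf C w\}$, with $\mu$ the first projection. $b$ is the Hermitian form associated to a closed real smooth $(1,1)$-form on $\widehat X$ which, on a neighborhood of $E$, is the pullback by the second projection of the Fubini–Study form on $\mathbf P(\mathbf C^n)$ induced by $\frac i2 \partial\bar\partial \log |v|^2$, with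 $|\cdot|$ the standard norm on $\mathbf C^n$. For all small enough $t>0$, $h_t = \mu^*h + tb$ is a Kähler metric on $\widehat X$. Coordinates adapted to $q \in E$. Write $q = (0,[w])$. After replacing $z$ by $x = f(z)$ for some unitary $f \in U(n)$ with $f([w]) = [0:\cdots:0:1]$, the coordinates $x$ are still centered at $p$ and normal for $h$. Using the chart of $\mathbf P(\mathbf C^n)$ where the last homogeneous coordinate is nonzero, normalized by $y_n = 1$, a neighborhood of $q$ in $\widehat X$ is the submanifold $\{(x,y) \in \mathbf C^n\times \mathbf C^{n-1} \mid x_j = y_j x_n,\ j=1,\ldots,n-1\}$ near $(0,0)$, and $q$ corresponds to $(0,0)$. Frame. Let $e_j = \partial/\partial x_j$ ($1 \le j\le n$) and $f_j = \partial/\partial y_j$ ($1\le j\le n-1$). Along $\widehat X$ near $(0,0)$, $T_{\widehat X}$ has the holomorphic frame $\xi_j = x_n e_j + f_j$ for $j=1,\ldots,n-1$, and $\xi_n = \sum_{j=1}^{n-1} y_j e_j + e_n$. For tangent fields $\alpha=\sum_j\alpha_j\xi_j$ and $\beta = \sum_k \beta_k \xi_k$, put $\tau(\alpha,\bar\beta) = \sum_{j=1}^{n-1}\alpha_j\bar\beta_j$. $H_h(e_n)$ denotes the holomorphic sectional curvature of $h$ at $p$ in the direction $e_n$. *)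

(* Defs.v *)
(* MathComp-Analysis; the complex numbers are R[i] for R : realType. *)
From HB Require Import structures.
From mathcomp Require Import all_boot all_order all_algebra.
From mathcomp Require Import all_classical all_reals all_analysis.
From mathcomp Require Import complex.

Set Implicit Arguments.
Unset Strict Implicit.
Unset Printing Implicit Defensive.

Import Order.TTheory GRing.Theory Num.Theory.
Import numFieldNormedType.Exports.

#[global] Open Scope classical_set_scope.
#[global] Open Scope ring_scope.
#[global] Open Scope complex_scope.
#[global] Open Scope sesquilinear_scope.

(* R[i] as a normed module over itself. *)
HB.instance Definition _ (R : rcfType) := NormedModule.copy R[i] R[i]^o.

(* C^n is 'rV[R[i]]_n.  All linear maps act on the right of row vectors, as
   'J does, and a sesquilinear form with matrix G sends (u, conj v) to
   u *m G *m v ^t*. *)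

(* Complex Frechet differentiability, the scalar field being R[i]. *)
Definition holomorphic_on (R : realType) (m n : nat)
    (U : set 'rV[R[i]]_m) (f : 'rV[R[i]]_m -> 'rV[R[i]]_n) : Prop :=
  forall u, U u -> differentiable f u.

Section RealCalculus.
Variables (R : realType) (n : nat).
Implicit Types (U : set 'rV[R[i]]_n) (F : 'rV[R[i]]_n -> R[i])
  (u v : 'rV[R[i]]_n).

Definition re_along F u v : R -> R := fun s => complex.Re (F (u + s%:C *: v)).
Definition im_along F u v : R -> R := fun s => complex.Im (F (u + s%:C *: v)).

(* Derivative of F along v for the real structure of C^n ('D_v would be the
   derivative with respect to a complex parameter). *)
Definition rderive v F u : R[i] :=
  derive1 (re_along F u v) 0 +i* derive1 (im_along F u v) 0.

Definition rderivable v F u : Prop :=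
  derivable (re_along F u v) 0 1 /\ derivable (im_along F u v) 0 1.

Fixpoint Ck (k : nat) U F : Prop :=
  (forall u, U u -> continuous_at u F) /\
  if k is k'.+1 then
    forall v, (forall u, U u -> rderivable v F u) /\ Ck k' U (rderive v F)
  else True.

Definition smooth_on U F : Prop := forall k, Ck k U F.

Definition dz (j : 'I_n) F u : R[i] :=
  2^-1 * (rderive (delta_mx 0 j) F u - 'i%C * rderive ('i%C *: delta_mx 0 j) F u).

Definition dzbar (j : 'I_n) F u : R[i] :=
  2^-1 * (rderive (delta_mx 0 j) F u + 'i%C * rderive ('i%C *: delta_mx 0 j) F u).

(* The coefficient R_{j kbar l mbar} of the Chern curvature of the metric with
   coefficients G.  The inverse g^{a bbar} is normalized by
   sum_b g_{c bbar} g^{a bbar} = delta_ac, so it is invmx G b a. *)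
Definition curv_coef (G : 'rV[R[i]]_n -> 'M[R[i]]_n) u (j k l m : 'I_n) : R[i] :=
  - dz j (dzbar k (fun v => G v l m)) u
  + \sum_(a < n) \sum_(b < n)
      invmx (G u) b a * dz j (fun v => G v l b) u * dzbar k (fun v => G v a m) u.

End RealCalculus.

Section Manifolds.
Variables (R : realType) (n : nat).

(* cinv is only meaningful on the image of cdom. *)
Record chart (X : Type) := Chart {
  cdom : set X;
  cfun :> X -> 'rV[R[i]]_n;
  cinv : 'rV[R[i]]_n -> X }.

Definition cimage (X : Type) (c : chart X) : set 'rV[R[i]]_n := c @` cdom c.

Definition is_chart (X : topologicalType) (c : chart X) : Prop :=
  [/\ open (cdom c), open (cimage c),
      forall x, cdom c x -> cinv c (c x) = x,
      forall x, cdom c x -> continuous_at x c &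
      forall u, cimage c u -> continuous_at u (cinv c)].

Definition transition (X : Type) (c d : chart X) : Prop :=
  holomorphic_on (c @` (cdom c `&` cdom d)) (d \o cinv c).

Record cmanifold := CManifold {
  cpoint :> topologicalType;
  chart_at : cpoint -> chart cpoint;
  chart_atP : forall x, is_chart (chart_at x) /\ cdom (chart_at x) x;
  chart_at_compat : forall x y, transition (chart_at x) (chart_at y);
  cmanifold_hausdorff : hausdorff_space cpoint;
  cmanifold_second_countable : @second_countable cpoint }.

(* The charts of the maximal atlas. *)
Definition holchart (M : cmanifold) (c : chart M) : Prop :=
  is_chart c /\
  forall x, transition c (chart_at x) /\ transition (chart_at x) c.

(* The fibre at x of the tangent bundle is C^n through the preferred chart
   chart_at x; a sesquilinear form on the tangent bundle is the family of its
   matrices in these preferred charts. *)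
Definition sform (M : cmanifold) : Type := M -> 'M[R[i]]_n.

(* Coefficients g(d/dc_j, conj(d/dc_k)) in an arbitrary holomorphic chart c. *)
Definition coef (M : cmanifold) (g : sform M) (c : chart M)
    (u : 'rV[R[i]]_n) : 'M[R[i]]_n :=
  let x := cinv c u in
  let J := 'J (chart_at x \o cinv c) u in
  J *m g x *m J ^t*.

Definition smooth_hermitian (M : cmanifold) (b : sform M) : Prop :=
  (forall x, (b x) ^t* = b x) /\
  forall c : chart M, holchart c ->
    forall j k, smooth_on (cimage c) (fun u => coef b c u j k).

(* d (i/2 sum_jk b_jk dz_j /\ dzbar_k) = 0. *)
Definition closed11 (M : cmanifold) (b : sform M) : Prop :=
  forall c : chart M, holchart c -> forall u, cimage c u -> forall j k l,
    dz l (fun v => coef b c v j k) u = dz j (fun v => coef b c v l k) u /\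
    dzbar l (fun v => coef b c v j k) u = dzbar k (fun v => coef b c v j l) u.

Definition kahler_metric (M : cmanifold) (g : sform M) : Prop :=
  [/\ smooth_hermitian g, closed11 g &
      forall x (v : 'rV[R[i]]_n), v != 0 -> 0 < (v *m g x *m v ^t*) 0 0].

(* R_g(A, conj B, C, conj D) at the point of coordinates u, for tangent vectors
   given by their components on the coordinate frame of the chart c. *)
Definition curvature (M : cmanifold) (g : sform M) (c : chart M)
    (u A B C D : 'rV[R[i]]_n) : R[i] :=
  \sum_(j < n) \sum_(k < n) \sum_(l < n) \sum_(m < n)
    curv_coef (coef g c) u j k l m
      * A 0 j * (B 0 k)^* * C 0 l * (D 0 m)^*.

Definition holo_sect_curv (M : cmanifold) (g : sform M) (c : chart M)
    (u A : 'rV[R[i]]_n) : R[i] :=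
  curvature g c u A A A A / ((A *m coef g c u *m A ^t*) 0 0) ^+ 2.

Definition normal_chart (M : cmanifold) (h : sform M) (p : M) (z : chart M) :
    Prop :=
  [/\ holchart z, cdom z p, z p = 0 &
      forall j k : 'I_n,
        (fun u : 'rV[R[i]]_n => coef h z u j k - (j == k)%:R)
          =O_ (nbhs (0 : 'rV[R[i]]_n)) (fun u => `|u| ^+ 2)].

Definition linear_chart (X : Type) (c : chart X) (f : 'M[R[i]]_n) : chart X :=
  Chart (cdom c) (fun x => c x *m f) (fun u => cinv c (u *m invmx f)).

End Manifolds.

Section Maps.
Variables (R : realType) (n : nat).

Definition local_rep (M N : cmanifold R n) (mu : M -> N) (x : M) :
    'rV[R[i]]_n -> 'rV[R[i]]_n :=
  chart_at (mu x) \o mu \o cinv (chart_at x).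

Definition holomap_on (M N : cmanifold R n) (U : set M) (mu : M -> N) : Prop :=
  forall x, U x ->
    continuous_at x mu /\ differentiable (local_rep mu x) (chart_at x x).

Definition pullback (M N : cmanifold R n) (mu : M -> N) (h : sform N) :
    sform M :=
  fun x => let J := 'J (local_rep mu x) (chart_at x x) in
    J *m h (mu x) *m J ^t*.

End Maps.

Section Blowup.
Variables (R : realType) (n : nat).

(* Points of P(C^n) are represented by one-dimensional subspaces of C^n. *)
Notation subspace := {vspace 'rV[R[i]]_n}.

(* On the part w_i <> 0 of the incidence variety {(v, [w]) | v \in C w}: the
   affine coordinates w_j / w_i (j <> i) of [w], with v_i in slot i. *)
Definition incidence_coord (i : 'I_n) (v w : 'rV[R[i]]_n) : 'rV[R[i]]_n :=
  \row_j if j == i then v 0 i else w 0 j / w 0 i.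

(* (z o mu, pi) is a biholomorphism of mu^-1 (dom z) onto the part over
   z (dom z) of the incidence variety.  Outside mu^-1 (dom z), the value of pi
   is irrelevant. *)
Definition incidence_model (X Xhat : cmanifold R n) (z : chart R n X)
    (mu : Xhat -> X) (pi : Xhat -> subspace) : Prop :=
  [/\ forall x, cdom z (mu x) -> \dim (pi x) = 1%N /\ z (mu x) \in pi x,
      forall v (L : subspace), cimage z v -> \dim L = 1%N -> v \in L ->
        exists! x, [/\ cdom z (mu x), z (mu x) = v & pi x = L] &
      forall i : 'I_n, exists c : chart R n Xhat, [/\ holchart c,
        cdom c = [set x | cdom z (mu x) /\ vpick (pi x) 0 i != 0] &
        forall x, cdom c x -> c x = incidence_coord i (z (mu x)) (vpick (pi x))]].

(* mu is the blowup at p, described by means of the chart z centered at p. *)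
Definition is_blowup (X Xhat : cmanifold R n) (p : X) (z : chart R n X)
    (mu : Xhat -> X) (pi : Xhat -> subspace) : Prop :=
  [/\ [/\ holchart z, cdom z p & z p = 0],
      holomap_on setT mu,
      exists nu : X -> Xhat, [/\ holomap_on (~` [set p]) nu,
        forall x, x <> p -> mu (nu x) = x &
        forall x, mu x <> p -> nu (mu x) = x] &
      incidence_model z mu pi].

Definition sqnorm (w : 'rV[R[i]]_n) : R :=
  \sum_(j < n) (complex.Re (w 0 j) ^+ 2 + complex.Im (w 0 j) ^+ 2).

(* On N, b is the pullback by pi of the Fubini-Study form on P(C^n), whose
   pullback by a holomorphic map [w] is i/2 d dbar log |w|^2 for every local
   holomorphic lift w to C^n \ {0}. *)
Definition fubini_study_on (Xhat : cmanifold R n) (N : set Xhat)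
    (pi : Xhat -> subspace) (b : sform Xhat) : Prop :=
  forall (c : chart R n Xhat) (V : set 'rV[R[i]]_n) (w : 'rV[R[i]]_n -> 'rV[R[i]]_n),
    holchart c -> open V -> V `<=` cimage c ->
    (forall u, V u -> N (cinv c u)) ->
    holomorphic_on V w ->
    (forall u, V u -> w u != 0 /\ pi (cinv c u) = <[w u]>%VS) ->
    forall u, V u -> forall j k,
      coef b c u j k = dz j (dzbar k (fun v => (ln (sqnorm (w v)))%:C)) u.

Definition is_form_b (X Xhat : cmanifold R n) (p : X) (z : chart R n X)
    (mu : Xhat -> X) (pi : Xhat -> subspace) (b : sform Xhat) : Prop :=
  [/\ smooth_hermitian b, closed11 b &
      exists N : set Xhat, [/\ open N, mu @^-1` [set p] `<=` N,
        N `<=` mu @^-1` cdom z & fubini_study_on N pi b]].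

Definition metric_t (X Xhat : cmanifold R n) (mu : Xhat -> X) (h : sform X)
    (b : sform Xhat) (t : R) : sform Xhat :=
  fun x => pullback mu h x + t%:C *: b x.

End Blowup.

(* From here on the dimension is n.+1; the last coordinate has index ord_max and
   the others are the lift ord_max i for i : 'I_n. *)
Section Adapted.
Variables (R : realType) (n : nat).
Variables (X Xhat : cmanifold R n.+1) (z : chart R n.+1 X) (mu : Xhat -> X)
  (pi : Xhat -> {vspace 'rV[R[i]]_n.+1}) (f : 'M[R[i]]_n.+1).

Definition affine_coord (w : 'rV[R[i]]_n.+1) : 'rV[R[i]]_n :=
  \row_(j < n) (w 0 (lift ord_max j) / w 0 ord_max).

Definition x_coord (x : Xhat) : 'rV[R[i]]_n.+1 := linear_chart z f (mu x).
Definition y_coord (x : Xhat) : 'rV[R[i]]_n := affine_coord (vpick (pi x) *m f).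

(* psi is the chart (y_1, ..., y_{n-1}, x_n) of the submanifold x_j = y_j x_n,
   on some neighbourhood of q. *)
Definition adapted_chart (q : Xhat) (psi : chart R n.+1 Xhat) : Prop :=
  [/\ holchart psi, cdom psi q &
      forall x, cdom psi x ->
        [/\ cdom z (mu x), (vpick (pi x) *m f) 0 ord_max != 0,
            forall j : 'I_n, psi x 0 (lift ord_max j) = y_coord x 0 j &
            psi x 0 ord_max = x_coord x 0 ord_max]].

(* The frame xi_1, ..., xi_n of T_Xhat, as vectors of C^n x C^{n-1} at the point
   (x, y). *)
Definition frame (x : 'rV[R[i]]_n.+1) (y : 'rV[R[i]]_n) (j : 'I_n.+1) :
    'rV[R[i]]_(n.+1 + n) :=
  if unlift ord_max j is Some i then
    row_mx (x 0 ord_max *: delta_mx 0 (lift ord_max i)) (delta_mx 0 i)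
  else
    row_mx (\sum_(i < n) y 0 i *: delta_mx 0 (lift ord_max i)
            + delta_mx 0 ord_max) 0.

(* The vector field with components A on the coordinate frame of psi is the
   holomorphic field sum_j alpha_j xi_j near the origin. *)
Definition tangent_field (psi : chart R n.+1 Xhat)
    (A alpha : 'rV[R[i]]_n.+1 -> 'rV[R[i]]_n.+1) : Prop :=
  \forall u \near (0 : 'rV[R[i]]_n.+1),
    differentiable alpha u /\
    A u *m 'J (fun v => row_mx (x_coord (cinv psi v)) (y_coord (cinv psi v))) u
    = \sum_(j < n.+1)
        alpha u 0 j *: frame (x_coord (cinv psi u)) (y_coord (cinv psi u)) j.

End Adapted.

Definition tau (R : realType) (n : nat) (a b : 'rV[R[i]]_n.+1) : R[i] :=
  \sum_(j < n) a 0 (lift ord_max j) * (b 0 (lift ord_max j))^*.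

(* Main.v *)
Require Import Defs.
From HB Require Import structures.
From mathcomp Require Import all_boot all_order all_algebra.
From mathcomp Require Import all_classical all_reals all_analysis.
From mathcomp Require Import complex.
From mathcomp Require Import ring.
Import Order.TTheory GRing.Theory Num.Theory.
Import numFieldNormedType.Exports.

(** Near q the manifold has the coordinates u = (y_1, ..., y_(n-1), s), in which
    the blowdown is u |-> s (y, 1) and the second projection is u |-> [y : 1].
    Let H be the matrix of h in the unitarily rotated chart; it is the identity
    to second order at 0.  The matrix of the pullback of h is J H J' with J the
    Jacobian of the blowdown and J' its conjugate transpose, and that of b is the
    complex Hessian of log (1 + |y|^2).

    The metric is C^2, has no term of order one at the origin, and therefore its
    curvature there is minus its mixed complex Hessian.  This Hessian is read off
    from the behaviour of the metric along the real rays r |-> r u, r -> 0+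
    (dz_dzbar_of_rays): a mixed second derivative is a limit of second
    differences (second_difference), hence depends only on the terms of order r^2.
    On a ray J (r u) = J_0 + r K (u), where J_0 retains only the entry (s, s).  So
    up to o(r^2) the pullback contributes the Hermitian form K K', responsible
    for the four terms in alpha_n conj(beta_n) tau and the like, and the entry
    H_nn restricted to the axis of s, responsible for the holomorphic sectional
    curvature (pullback_ray).  The potential log (1 + |y|^2) contributes the
    curvature of the Fubini-Study metric (fubini_study_ray).  These combine into
    curv_coef_blowup.

    The geometric part shows that the adapted chart sends q to 0, that in it the
    blowdown has the form above (adapted_blowdown), that the chain rule turns the
    pullback of h into J H J' (coef_pullback), that b is given by the potential
    because (y, 1) is a local lift of the projection up to a unitary map
    (coef_fubini_study), and that at the origin a field with components alpha on
    the frame xi has the same components on the coordinate frame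
    (tangent_field0). *)

Set Implicit Arguments.
Unset Strict Implicit.

(** * Second differences along real rays *)

Section RealLines.
(* With ring_scope innermost, x^* stands for Num.conj. *)
Local Open Scope ring_scope.
Variable R : realType.
Notation C := R[i].

Lemma real_complex_continuous : continuous (fun x : R => x%:C).
Proof.
move=> x; apply/cvgrPdist_lt => -[e e'] /[!ltcE] /= /andP[/eqP-> e0].
near=> y; rewrite -rmorphB normc_def /= expr0n /= addr0 sqrtr_sqr ltcR.
by near: y; apply: cvgr_dist_lt.
Unshelve. all: by end_near. Qed.

Lemma Re_scale (r : R) (z : C) : complex.Re (r%:C * z) = r * complex.Re z.
Proof. by case: z => a b /=; rewrite mul0r subr0. Qed.

Lemma Im_scale (r : R) (z : C) : complex.Im (r%:C * z) = r * complex.Im z.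
Proof. by case: z => a b /=; rewrite mul0r addr0. Qed.

Lemma ReB (y z : C) : complex.Re (y - z) = complex.Re y - complex.Re z.
Proof. by case: y z => [? ?] []. Qed.

Lemma ImB (y z : C) : complex.Im (y - z) = complex.Im y - complex.Im z.
Proof. by case: y z => [? ?] []. Qed.

Lemma ReD (y z : C) : complex.Re (y + z) = complex.Re y + complex.Re z.
Proof. by case: y z => [? ?] []. Qed.

Lemma ImD (y z : C) : complex.Im (y + z) = complex.Im y + complex.Im z.
Proof. by case: y z => [? ?] []. Qed.

Lemma Re_mulNi (z : C) : complex.Re (- 'i%C * z) = complex.Im z.
Proof. by case: z => a b; rewrite /= oppr0 mul0r mulN1r sub0r opprK. Qed.

Lemma Re_continuous : continuous (@complex.Re R : C -> R).
Proof.
move=> z; apply/(@cvgrPdist_lt _ _ _ (nbhs z)) => e e0; near=> y.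
rewrite -ReB -ltcR; apply: le_lt_trans (normc_ge_Re _) _.
near: y; suff: \forall y \near z, `|z - y| < e%:C by [].
by apply: (@cvgr_dist_lt _ _ _ (nbhs z) _ id) => //; rewrite ltcR.
Unshelve. all: by end_near. Qed.

Lemma Im_continuous : continuous (@complex.Im R : C -> R).
Proof.
move=> z; apply/(@cvgrPdist_lt _ _ _ (nbhs z)) => e e0; near=> y.
rewrite -ImB -Re_mulNi -ltcR; apply: le_lt_trans (normc_ge_Re _) _.
rewrite normrM normrN normc_def /= expr0n expr1n add0r sqrtr1 mul1r.
near: y; suff: \forall y \near z, `|z - y| < e%:C by [].
by apply: (@cvgr_dist_lt _ _ _ (nbhs z) _ id) => //; rewrite ltcR.
Unshelve. all: by end_near. Qed.

Lemma cvg_complex T (F : set_system T) {FF : Filter F} (f : T -> C) (c : C) :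
    complex.Re (f x) @[x --> F] --> complex.Re c ->
    complex.Im (f x) @[x --> F] --> complex.Im c -> f x @[x --> F] --> c.
Proof.
move=> fRe fIm; rewrite (complexE c) (_ : f = fun x =>
  (complex.Re (f x))%:C + 'i%C * (complex.Im (f x))%:C); last first.
  by apply: funext => x; exact: complexE.
apply: cvgD; first exact: (continuous_cvg _ (@real_complex_continuous _) fRe).
apply: cvgM; first exact: cvg_cst.
exact: (continuous_cvg _ (@real_complex_continuous _) fIm).
Qed.

Section Rays.
Variable n : nat.
Notation V := 'rV[C]_n.
Implicit Types (u v w : V) (F : V -> C).

Lemma cvg_ray0 v : s%:C *: v @[s --> (0 : R)] --> (0 : V).
Proof.
rewrite -[X in _ --> X](scale0r v); apply: cvgZr_tmp; exact: real_complex_continuous.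
Qed.

(** The sets on which second differences are evaluated shrink to 0. *)
Lemma near_parallelogram v w (P : V -> Prop) : (\forall u \near (0 : V), P u) ->
  \forall s \near (0 : R)^'+, forall a b : R, 0 <= a <= s -> 0 <= b <= s ->
    P (a%:C *: v + b%:C *: w).
Proof.
move=> P0; have : (p.1%:C *: v + p.2%:C *: w) @[p --> ((0 : R), (0 : R))] --> (0 : V).
  rewrite -[X in _ --> X]addr0; apply: cvgD.
    exact: (@cvg_comp _ _ _ fst (fun s : R => s%:C *: v) _ _ _ cvg_fst (@cvg_ray0 v)).
  exact: (@cvg_comp _ _ _ snd (fun s : R => s%:C *: w) _ _ _ cvg_snd (@cvg_ray0 w)).
move=> /(_ _ P0) /nbhs_ballP[d /= d0 dP]; near=> s => a b /andP[a0 as_] /andP[b0 bs].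
apply: (dP (a, b)); split; rewrite /= /ball /= sub0r normrN ger0_norm//.
  by apply: le_lt_trans as_ _; near: s; exact: nbhs_right_lt.
by apply: le_lt_trans bs _; near: s; exact: nbhs_right_lt.
Unshelve. all: by end_near. Qed.

(** Differentiability along lines is phrased at the parameter 0 of each base
    point; this moves it to the parameter t of a fixed line. *)
Lemma is_derive_line (f : V -> R) (u w : V) (t d : R) :
  is_derive (0 : R) 1 (fun s => f (u + t%:C *: w + s%:C *: w)) d ->
  is_derive t 1 (fun s => f (u + s%:C *: w)) d.
Proof.
move=> H.
have H' := @is_derive1_comp _ (fun s => f (u + t%:C *: w + s%:C *: w)) (fun s : R => s - t) t d 1.
rewrite (_ : (fun s => _) = (fun s => f (u + t%:C *: w + s%:C *: w)) \o (fun s : R => s - t)).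
  rewrite -[d]mulr1; apply: H'; rewrite ?subrr//.
  by apply: is_derive_eq; rewrite subr0.
apply: funext => s /=.
by rewrite -addrA -scalerDl -rmorphD /= [t + _]addrC subrK.
Qed.

Lemma line_MVT (f f1 : V -> R) u w (s : R) : 0 <= s ->
    (forall t, 0 <= t <= s ->
       is_derive (0 : R) 1 (fun r => f (u + t%:C *: w + r%:C *: w)) (f1 (u + t%:C *: w))) ->
  exists2 c, 0 <= c <= s & f (u + s%:C *: w) - f u = s * f1 (u + c%:C *: w).
Proof.
move=> s0 H.
have H' t : 0 <= t <= s -> is_derive t 1 (fun r => f (u + r%:C *: w)) (f1 (u + t%:C *: w)).
  by move=> /H; exact: is_derive_line.
have [||c] := @MVT_segment R (fun r => f (u + r%:C *: w)) (fun t => f1 (u + t%:C *: w)) 0 s s0.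
- by move=> x; rewrite in_itv /= => /andP[x0 xs]; apply: H'; rewrite !ltW.
- apply: derivable_within_continuous => x; rewrite in_itv /= => xs.
  by have [] := H' _ xs.
by rewrite in_itv /= => cs; rewrite scale0r addr0 subr0 mulrC; exists c.
Qed.

(** Two applications of the mean value theorem, first to the increment of
    u |-> f (s v + u) - f u along w, then to that of f1 along v, turn the second
    difference into s^2 times a value of f2 in the parallelogram of sides s v and
    s w. *)
Lemma second_difference_real (f f1 f2 : V -> R) (U : set V) v w :
    open U -> U 0 ->
    (forall u, U u -> is_derive (0 : R) 1 (fun s => f (u + s%:C *: w)) (f1 u)) ->
    (forall u, U u -> is_derive (0 : R) 1 (fun s => f1 (u + s%:C *: v)) (f2 u)) ->
    f2 u @[u --> (0 : V)] --> f2 0 ->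
  s ^- 2 * (f (s%:C *: (v + w)) - f (s%:C *: v) - f (s%:C *: w) + f 0) @[s --> 0^'+]
    --> f2 0.
Proof.
move=> oU /(fun U0 => open_nbhs_nbhs (conj oU U0)) U0 Hf Hf1 cf2; apply/(@cvgrPdist_le R R) => e e0.
have /(near_parallelogram v w) nf2 : \forall u \near (0 : V), U u /\ `|f2 0 - f2 u| <= e.
  by near=> u; split; near: u => //; move/cvgrPdist_le: cf2; apply.
near=> s.
have s0 : 0 < s by near: s; exact: nbhs_right_gt.
have S : forall a b : R, 0 <= a <= s -> 0 <= b <= s ->
    U (a%:C *: v + b%:C *: w) /\ `|f2 0 - f2 (a%:C *: v + b%:C *: w)| <= e.
  by near: s.
have s1 : (0 : R) <= s <= s by rewrite lexx ltW.
have s2 : (0 : R) <= 0 <= s by rewrite lexx ltW.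
pose g (u : V) : R := f (s%:C *: v + u) - f u.
pose g1 (u : V) : R := f1 (s%:C *: v + u) - f1 u.
have E t : 0 + t%:C *: w = t%:C *: w := add0r _.
have Hg : forall t, 0 <= t <= s ->
       is_derive (0 : R) 1 (fun r => g (0 + t%:C *: w + r%:C *: w)) (g1 (0 + t%:C *: w)).
  move=> t ts; rewrite (E t).
  have D1 : is_derive (0 : R) 1 (fun r => f (s%:C *: v + t%:C *: w + r%:C *: w))
      (f1 (s%:C *: v + t%:C *: w)).
    by apply: Hf; have [] := S _ _ s1 ts.
  have D2 : is_derive (0 : R) 1 (fun r => f (t%:C *: w + r%:C *: w)) (f1 (t%:C *: w)).
    by apply: Hf; have [] := S _ _ s2 ts; rewrite scale0r (E t).
  have := is_deriveB D1 D2.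
  under eq_fun do rewrite -addrA.
  by [].
have [c cs] := @line_MVT g g1 0 w s (ltW s0) Hg.
rewrite (E s) (E c) /g (addr0 (s%:C *: v)) => Ec.
have [|c' cs' Ec'] := @line_MVT f1 f2 (c%:C *: w) v s (ltW s0).
  by move=> t ts; apply: Hf1; rewrite addrC; have [] := S _ _ ts cs.
rewrite (addrC (c%:C *: w) (s%:C *: v)) (addrC (c%:C *: w) (c'%:C *: v)) in Ec'.
rewrite /g1 Ec' in Ec.
rewrite (_ : _ * _ = f2 (c'%:C *: v + c%:C *: w)); first by have [] := S _ _ cs' cs.
apply: (mulfI (expf_neq0 2 (lt0r_neq0 s0))); rewrite mulVKf ?expf_neq0 ?lt0r_neq0//.
rewrite scalerDr expr2 -mulrA -Ec.
by rewrite opprB addrA [RHS]addrAC; congr (_ + _); rewrite addrAC.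
Unshelve. all: by end_near. Qed.

End Rays.

End RealLines.

Section ComplexLines.
Local Open Scope ring_scope.
Variables (R : realType) (n : nat).
Notation C := R[i].
Notation V := 'rV[C]_n.
Implicit Types (u v w : V) (F : V -> C) (U : set V).

Lemma rderivable_Re v F u : rderivable v F u ->
  is_derive (0 : R) 1 (fun s => complex.Re (F (u + s%:C *: v))) (complex.Re (rderive v F u)).
Proof. by move=> [H _]; rewrite /rderive /= derive1E; exact: derivableP. Qed.

Lemma rderivable_Im v F u : rderivable v F u ->
  is_derive (0 : R) 1 (fun s => complex.Im (F (u + s%:C *: v))) (complex.Im (rderive v F u)).
Proof. by move=> [_ H]; rewrite /rderive /= derive1E; exact: derivableP. Qed.

Lemma Ck1_rderivable U F u v : Ck 1 U F -> U u -> rderivable v F u.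
Proof. by move=> [_ /(_ v) [H _]] /H. Qed.

Lemma Ck1_cvg U F u v : Ck 1 U F -> U u -> rderive v F x @[x --> u] --> rderive v F u.
Proof. by move=> [_ /(_ v) [_ [H _]]] /H. Qed.

Lemma Ck2_rderive U F v : Ck 2 U F -> Ck 1 U (rderive v F).
Proof. by move=> [_ /(_ v) []]. Qed.

Lemma Ck2_Ck1 U F : Ck 2 U F -> Ck 1 U F.
Proof. by move=> [c H]; split; [exact: c|move=> v; have [Hv [cv _]] := H v; split]. Qed.

(** Hence the second derivatives at 0 are determined by the values on rays up to
    o(s^2), and no chain or product rule of order two enters. *)
Lemma second_difference U F v w : open U -> U 0 -> Ck 2 U F ->
  (s ^- 2)%:C * (F (s%:C *: (v + w)) - F (s%:C *: v) - F (s%:C *: w) + F 0)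
    @[s --> (0 : R)^'+] --> rderive v (rderive w F) 0.
Proof.
move=> oU U0 F2; have c2 := @Ck1_cvg U _ 0 v (Ck2_rderive w F2) U0.
apply: (@cvg_complex R R).
  under eq_fun do rewrite Re_scale ReD !ReB.
  apply: (@second_difference_real R n
    (fun u => complex.Re (F u)) (fun u => complex.Re (rderive w F u))
    (fun u => complex.Re (rderive v (rderive w F) u)) U v w oU U0).
  - by move=> u Uu; apply: rderivable_Re; exact: Ck1_rderivable (Ck2_Ck1 F2) Uu.
  - by move=> u Uu; apply: rderivable_Re; exact: Ck1_rderivable (Ck2_rderive w F2) Uu.
  - exact: (continuous_cvg _ (@Re_continuous _ _) c2).
under eq_fun do rewrite Im_scale ImD !ImB.
apply: (@second_difference_real R n
  (fun u => complex.Im (F u)) (fun u => complex.Im (rderive w F u))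
  (fun u => complex.Im (rderive v (rderive w F) u)) U v w oU U0).
- by move=> u Uu; apply: rderivable_Im; exact: Ck1_rderivable (Ck2_Ck1 F2) Uu.
- by move=> u Uu; apply: rderivable_Im; exact: Ck1_rderivable (Ck2_rderive w F2) Uu.
- exact: (continuous_cvg _ (@Im_continuous _ _) c2).
Qed.

Lemma is_derive_right (f : R -> R) (d : R) : is_derive (0 : R) 1 f d ->
  s^-1 * (f s - f 0) @[s --> 0^'+] --> d.
Proof.
move=> [/cvg_dnbhs_at_right H <-]; move: H; rewrite /derive.
rewrite (_ : (fun h : R => _) = fun s => s^-1 * (f s - f 0))//.
by apply: funext => h /=; rewrite [h%:A]mulr1 addr0.
Qed.

Lemma first_difference F v : rderivable v F 0 ->
  (s^-1)%:C * (F (s%:C *: v) - F 0) @[s --> (0 : R)^'+] --> rderive v F 0.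
Proof.
move=> Fv; apply: (@cvg_complex R R).
  under eq_fun do rewrite Re_scale ReB.
  have := is_derive_right (rderivable_Re Fv).
  by under eq_fun do rewrite scale0r !add0r.
under eq_fun do rewrite Im_scale ImB.
have := is_derive_right (rderivable_Im Fv).
by under eq_fun do rewrite scale0r !add0r.
Qed.

(** The displacement s^2 v is multiplied by a derivative which tends to 0. *)
Lemma shear_real (f f1 : V -> R) U p v : open U -> U 0 ->
    (forall u, U u -> is_derive (0 : R) 1 (fun s => f (u + s%:C *: v)) (f1 u)) ->
    f1 u @[u --> (0 : V)] --> (0 : R) ->
  s ^- 2 * (f (s%:C *: p + (s ^+ 2)%:C *: v) - f (s%:C *: p)) @[s --> 0^'+] --> (0 : R).
Proof.
move=> oU /(fun H : U 0 => open_nbhs_nbhs (conj oU H)) U0 Hf cf1.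
apply/(@cvgrPdist_le R R) => e e0.
have /(near_parallelogram p v) nf1 : \forall u \near (0 : V), U u /\ `|f1 u| <= e.
  near=> u; split; near: u => //; move/(@cvgr0Pnorm_le R R) : cf1; exact.
near=> s.
have s0 : 0 < s by near: s; exact: nbhs_right_gt.
have S : forall a b : R, 0 <= a <= s -> 0 <= b <= s ->
    U (a%:C *: p + b%:C *: v) /\ `|f1 (a%:C *: p + b%:C *: v)| <= e by near: s.
have s1 : (0 : R) <= s <= s by rewrite lexx ltW.
have s2 : s ^+ 2 <= s.
  rewrite -[leRHS]mulr1 expr2 ler_wpM2l ?ltW//; near: s; exact: nbhs_right_lt.
have [|c /andP[c0 cs] ->] := @line_MVT R n f f1 (s%:C *: p) v (s ^+ 2) (sqr_ge0 s).
  by move=> t /andP[t0 ts]; apply: Hf; have [] := S _ t s1; rewrite ?t0 ?(le_trans ts).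
rewrite mulKf ?expf_neq0 ?lt0r_neq0// sub0r normrN.
by have [] := S _ c s1; rewrite ?c0 ?(le_trans cs).
Unshelve. all: by end_near. Qed.

(** Along the image of a ray under the blowdown, the quadratic part of the
    displacement is invisible at order s^2 to a function with vanishing
    differential. *)
Lemma shear U F p v : open U -> U 0 -> Ck 1 U F -> rderive v F 0 = 0 ->
  (s ^- 2)%:C * (F (s%:C *: p + (s ^+ 2)%:C *: v) - F (s%:C *: p))
    @[s --> (0 : R)^'+] --> (0 : C).
Proof.
move=> oU U0 F1 dF; have c1 := @Ck1_cvg U F 0 v F1 U0; move: c1; rewrite dF => c1.
apply: (@cvg_complex R R).
  under eq_fun do rewrite Re_scale ReB.
  apply: (@shear_real (fun u => complex.Re (F u)) (fun u => complex.Re (rderive v F u)) U p v oU U0).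
    by move=> u Uu; apply: rderivable_Re; exact: Ck1_rderivable F1 Uu.
  exact: (continuous_cvg _ (@Re_continuous _ _) c1).
under eq_fun do rewrite Im_scale ImB.
apply: (@shear_real (fun u => complex.Im (F u)) (fun u => complex.Im (rderive v F u)) U p v oU U0).
  by move=> u Uu; apply: rderivable_Im; exact: Ck1_rderivable F1 Uu.
exact: (continuous_cvg _ (@Im_continuous _ _) c1).
Qed.

End ComplexLines.

(** * Ray expansions and Wirtinger derivatives *)

Section CurveDerivative.
Local Open Scope ring_scope.
Variable R : realType.
Notation C := R[i].
Implicit Types (g h : R -> C) (c d e : C).

(** A relational form of rderive: existence and value of the derivative are
    carried together through sums, products and conjugates. *)
Definition cderive g d :=
  is_derive (0 : R) 1 (fun s => complex.Re (g s)) (complex.Re d) /\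
  is_derive (0 : R) 1 (fun s => complex.Im (g s)) (complex.Im d).

Lemma cderive_eq g d e : cderive g d -> d = e -> cderive g e.
Proof. by move=> H <-. Qed.

Lemma cderive_cst c : cderive (fun=> c) 0.
Proof. by split; exact: is_derive_cst. Qed.

Lemma cderiveD g h d e : cderive g d -> cderive h e ->
  cderive (fun s => g s + h s) (d + e).
Proof.
move=> [gr gi] [hr hi]; split.
  rewrite ReD; have := is_deriveD gr hr.
  by rewrite (_ : _ + _ = fun s => complex.Re (g s + h s))//; apply: funext => s; rewrite ReD.
rewrite ImD; have := is_deriveD gi hi.
by rewrite (_ : _ + _ = fun s => complex.Im (g s + h s))//; apply: funext => s; rewrite ImD.
Qed.

Lemma ReM (y z : C) : complex.Re (y * z) = complex.Re y * complex.Re z - complex.Im y * complex.Im z.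
Proof. by case: y z => [? ?] []. Qed.

Lemma ImM (y z : C) : complex.Im (y * z) = complex.Re y * complex.Im z + complex.Im y * complex.Re z.
Proof. by case: y z => [? ?] []. Qed.

Lemma cderiveM g h d e : cderive g d -> cderive h e ->
  cderive (fun s => g s * h s) (d * h 0 + g 0 * e).
Proof.
move=> [gr gi] [hr hi]; split.
  have := is_deriveB (is_deriveM gr hr) (is_deriveM gi hi).
  rewrite (_ : _ - _ = fun s => complex.Re (g s * h s)); last first.
    by apply: funext => s; rewrite ReM.
  by move/is_derive_eq; apply; rewrite !ReD !ReM /GRing.scale /=; ring.
have := is_deriveD (is_deriveM gr hi) (is_deriveM gi hr).
rewrite (_ : _ + _ = fun s => complex.Im (g s * h s)); last first.
  by apply: funext => s; rewrite ImM.
by move/is_derive_eq; apply; rewrite !ImD !ImM /GRing.scale /=; ring.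
Qed.

Lemma cderiveZ c g d : cderive g d -> cderive (fun s => c * g s) (c * d).
Proof.
move=> H; apply: cderive_eq (cderiveM (cderive_cst c) H) _.
by rewrite mul0r add0r.
Qed.

Lemma cderive_conj g d : cderive g d -> cderive (fun s => (g s)^*) d^*.
Proof.
move=> [gr gi]; split.
  rewrite (_ : complex.Re d^* = complex.Re d); last by case: (d).
  by rewrite (_ : (fun s => _) = fun s => complex.Re (g s))//; apply: funext => s; case: (g s).
rewrite (_ : complex.Im d^* = - complex.Im d); last by case: (d).
have := is_deriveN gi.
rewrite (_ : - _ = fun s => complex.Im (g s)^*)//.
by apply: funext => s /=; rewrite /GRing.opp /=; case: (g s).
Qed.

Lemma cderive_sum (I : Type) (r : seq I) (P : pred I) (g : I -> R -> C) (d : I -> C) :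
    (forall i, cderive (g i) (d i)) ->
  cderive (fun s => \sum_(i <- r | P i) g i s) (\sum_(i <- r | P i) d i).
Proof.
move=> H; elim: r => [|i r IH].
  rewrite big_nil; under eq_fun do rewrite big_nil; exact: cderive_cst.
rewrite big_cons; under eq_fun do rewrite big_cons.
by case: ifP => // _; exact: cderiveD.
Qed.

Lemma cderive_affine (a b : C) : cderive (fun s => a + s%:C * b) b.
Proof.
split.
  under eq_fun do rewrite ReD Re_scale.
  apply: is_derive_eq; rewrite add0r; set x := complex.Re b.
  by rewrite scaler0 add0r /GRing.scale /= ?mul1r ?mulr1.
under eq_fun do rewrite ImD Im_scale.
apply: is_derive_eq; rewrite add0r; set x := complex.Im b.
by rewrite scaler0 add0r /GRing.scale /= ?mul1r ?mulr1.
Qed.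

Lemma cderive_real (f : R -> R) (d : R) : is_derive (0 : R) 1 f d -> cderive (fun s => (f s)%:C) d%:C.
Proof. by move=> H; split => //=; exact: is_derive_cst. Qed.

Variable n : nat.
Notation V := 'rV[C]_n.

Lemma rderiveE v (F : V -> C) u d : cderive (fun s => F (u + s%:C *: v)) d -> rderive v F u = d.
Proof.
move=> [[_ H1] [_ H2]]; rewrite /rderive !derive1E /re_along /im_along H1 H2.
by case: (d).
Qed.

Lemma rderivableP v (F : V -> C) u : rderivable v F u ->
  cderive (fun s => F (u + s%:C *: v)) (rderive v F u).
Proof. by move=> H; split; [exact: rderivable_Re|exact: rderivable_Im]. Qed.

Lemma dz_dzbarE (U : set V) (F : V -> C) (j k : 'I_n) : U 0 -> Ck 2 U F ->
  dz j (dzbar k F) 0 = 4^-1 * (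
    rderive (delta_mx 0 j) (rderive (delta_mx 0 k) F) 0
    + 'i%C * rderive (delta_mx 0 j) (rderive ('i%C *: delta_mx 0 k) F) 0
    - 'i%C * (rderive ('i%C *: delta_mx 0 j) (rderive (delta_mx 0 k) F) 0
      + 'i%C * rderive ('i%C *: delta_mx 0 j) (rderive ('i%C *: delta_mx 0 k) F) 0)).
Proof.
move=> U0 F2.
have E v : rderive v (dzbar k F) 0 = 2^-1 * (rderive v (rderive (delta_mx 0 k) F) 0
    + 'i%C * rderive v (rderive ('i%C *: delta_mx 0 k) F) 0).
  apply: rderiveE; apply: cderiveZ; apply: cderiveD.
    exact: rderivableP (Ck1_rderivable _ (Ck2_rderive _ F2) U0).
  apply: cderiveZ; exact: rderivableP (Ck1_rderivable _ (Ck2_rderive _ F2) U0).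
rewrite /dz !E (_ : 4 = 2 * 2)//; last by rewrite -natrM.
by rewrite invfM -!mulrA; congr (_ * _); rewrite mulrBr mulrCA.
Qed.

End CurveDerivative.

(** The form in which uniqueness of limits is applied to expansions that hold
    for small parameters only. *)
Lemma cvg_near_unique (R : realType) (F : set_system R) {FF : ProperFilter F}
    (f g : R -> R[i]) (a b : R[i]) :
    (\forall s \near F, f s = g s) -> f s @[s --> F] --> a -> g s @[s --> F] --> b -> a = b.
Proof.
move=> fg fa gb; have ga : g s @[s --> F] --> a by apply: cvg_trans fa; exact: near_eq_cvg.
exact: (cvg_unique (@norm_hausdorff _ _) ga gb).
Qed.

Section RayExpansions.
Local Open Scope ring_scope.
Variables (R : realType) (n : nat).
Notation C := R[i].
Notation V := 'rV[C]_n.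
Variables (U U' : set V) (g k : V -> C) (x : C) (L : {linear V -> V}) (Q : V -> C).
Hypotheses (oU : open U) (U0 : U 0) (g2 : Ck 2 U g).
Hypotheses (oU' : open U') (U'0 : U' 0) (k2 : Ck 2 U' k).
Let T u (s : R) := g (s%:C *: u) - g 0 - x * (k (s%:C *: L u) - k 0).
Hypothesis TQ : forall u, (s ^- 2)%:C * T u s @[s --> (0 : R)^'+] --> Q u.

(** After division by s, the terms of order s^2 disappear. *)
Lemma rderive_of_rays v : rderive v g 0 = x * rderive (L v) k 0.
Proof.
apply/eqP; rewrite -subr_eq0; apply/eqP.
have A : (s^-1)%:C * (g (s%:C *: v) - g 0) - x * ((s^-1)%:C * (k (s%:C *: L v) - k 0))
    @[s --> (0 : R)^'+] --> rderive v g 0 - x * rderive (L v) k 0.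
  apply: cvgB; first exact: first_difference (Ck1_rderivable _ (Ck2_Ck1 g2) U0).
  apply: cvgM; first exact: cvg_cst.
  exact: first_difference (Ck1_rderivable _ (Ck2_Ck1 k2) U'0).
have B : s%:C * ((s ^- 2)%:C * T v s) @[s --> (0 : R)^'+] --> 0 * Q v.
  apply: cvgM; last exact: TQ.
  apply: cvg_at_right_filter; exact: real_complex_continuous.
move: B; rewrite (mul0r (Q v)) => B.
apply: (cvg_near_unique _ A B); near=> s.
have s0 : s != 0 by apply: lt0r_neq0; near: s; exact: nbhs_right_gt.
have E : s%:C * (s ^- 2)%:C = (s^-1)%:C by rewrite -rmorphM /= expr2 invfM mulrA divff// mul1r.
by rewrite [RHS]mulrA E /T [RHS]mulrBr; congr (_ - _); rewrite mulrCA.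
Unshelve. all: by end_near. Qed.

(** The second difference of g - x (k o L) is the second difference of its ray
    expansion, that is, the polarization of Q. *)
Lemma rderive2_of_rays v w : rderive v (rderive w g) 0 =
  x * rderive (L v) (rderive (L w) k) 0 + (Q (v + w) - Q v - Q w).
Proof.
apply/eqP; rewrite addrC -subr_eq; apply/eqP.
pose D (F : V -> C) a b (s : R) := (s ^- 2)%:C *
  (F (s%:C *: (a + b)) - F (s%:C *: a) - F (s%:C *: b) + F 0).
have A : D g v w s - x * D k (L v) (L w) s @[s --> (0 : R)^'+] -->
    rderive v (rderive w g) 0 - x * rderive (L v) (rderive (L w) k) 0.
  apply: cvgB; first exact: second_difference oU U0 g2.
  apply: cvgM; first exact: cvg_cst.
  exact: second_difference oU' U'0 k2.
have B : (s ^- 2)%:C * T (v + w) s - (s ^- 2)%:C * T v s - (s ^- 2)%:C * T w s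
    @[s --> (0 : R)^'+] --> Q (v + w) - Q v - Q w.
  by apply: cvgB; [apply: cvgB|]; exact: TQ.
apply: (cvg_near_unique _ A B); near=> s.
rewrite /D /T (linearD L v w).
move: (s ^- 2)%:C (g _) (g _) (g _) (g _) (k _) (k _) (k _) (k _).
move=> c g1 g2' g3 g4 k1 k2' k3 k4.
ring.
Unshelve. all: by end_near. Qed.

End RayExpansions.

Section Wirtinger.
Local Open Scope ring_scope.
Variables (R : realType) (n : nat).
Notation C := R[i].
Notation V := 'rV[C]_n.
Implicit Types (u v w : V).

Lemma rderive0 (F : V -> C) u : rderive 0 F u = 0.
Proof.
apply: rderiveE; rewrite (_ : (fun s => _) = fun=> F u); first exact: cderive_cst.
by apply: funext => s; rewrite scaler0 (addr0 u).
Qed.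

Lemma rderive_cst v (c : C) u : rderive v (fun=> c) u = 0.
Proof. by apply: rderiveE; exact: cderive_cst. Qed.

Lemma conj_i : ('i%C : C)^* = - 'i%C.
Proof. by apply/eqP; rewrite eq_complex /= oppr0 !eqxx. Qed.

Lemma i_mul_i : 'i%C * 'i%C = -1 :> C.
Proof. by rewrite -expr2 sqr_i. Qed.

(** In the combination defining dz and dzbar, the contribution c of the term
    linear in the first argument adds up and the conjugate contribution c'
    cancels. *)
Lemma wirtinger_combination (c c' x d1 d2 d3 d4 g1 g2 g3 g4 : C) :
    g1 = x * d1 + (c * (1 * 1^*) + c' * (1 * 1^*)) ->
    g2 = x * d2 + (c * (1 * 'i%C^*) + c' * ('i%C * 1^*)) ->
    g3 = x * d3 + (c * ('i%C * 1^*) + c' * (1 * 'i%C^*)) ->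
    g4 = x * d4 + (c * ('i%C * 'i%C^*) + c' * ('i%C * 'i%C^*)) ->
  4^-1 * (g1 + 'i%C * g2 - 'i%C * (g3 + 'i%C * g4)) =
  c + x * (4^-1 * (d1 + 'i%C * d2 - 'i%C * (d3 + 'i%C * d4))).
Proof.
rewrite conj_i rmorph1 => -> -> -> ->; move: ('i%C : C) i_mul_i => i i2.
have -> : 4^-1 * (x * d1 + (c * (1 * 1) + c' * (1 * 1))
    + i * (x * d2 + (c * (1 * - i) + c' * (i * 1)))
    - i * (x * d3 + (c * (i * 1) + c' * (1 * - i))
      + i * (x * d4 + (c * (i * - i) + c' * (i * - i))))) =
  x * (4^-1 * (d1 + i * d2 - i * (d3 + i * d4)))
    + 4^-1 * (c + c' - (i * i) * (c - c') - (i * i) * (c - c')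
      + (i * i) * (i * i) * (c + c')) by ring.
by rewrite i2; field.
Qed.

Variable c : 'I_n -> 'I_n -> C.
Let B v w := \sum_a \sum_b c a b * (v 0 a * (w 0 b)^*).
Let Q v := B v v.

Lemma polarization v w : Q (v + w) - Q v - Q w = B v w + B w v.
Proof.
suff -> : Q (v + w) = Q v + B v w + (B w v + Q w) by ring.
rewrite /Q /B -!big_split; apply: eq_bigr => a _; rewrite -!big_split; apply: eq_bigr => b _ /=.
by rewrite !mxE rmorphD /= mulrDl !mulrDr !addrA.
Qed.

Lemma sesqui_delta (x y : C) j k : B (x *: delta_mx 0 j) (y *: delta_mx 0 k) = c j k * (x * y^*).
Proof.
rewrite /B (bigD1 j) //= (bigD1 k) //= !mxE !eqxx !mulr1.
rewrite big1 => [|b /negPf bk]; last by rewrite !mxE bk andbF mulr0 rmorph0 !mulr0.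
rewrite big1 => [|a /negPf aj]; first by rewrite !addr0.
by rewrite big1 => // b _; rewrite !mxE aj andbF mulr0 mul0r mulr0.
Qed.

Variables (p : 'I_n) (U U' : set V) (g h : V -> C) (x : C).
Hypotheses (oU : open U) (U0 : U 0) (g2 : Ck 2 U g).
Hypotheses (oU' : open U') (U'0 : U' 0) (h2 : Ck 2 U' h).
Hypothesis TQ : forall u, (s ^- 2)%:C *
    (g (s%:C *: u) - g 0 - x * (h (s%:C *: (u *m delta_mx p p)) - h 0))
  @[s --> (0 : R)^'+] --> Q u.

(** Multiplication by delta_mx p p is the projection on the axis p. *)
Lemma delta_proj (y : C) j : (y *: delta_mx 0 j : V) *m delta_mx p p =
  if j == p then y *: delta_mx 0 p else 0.
Proof.
rewrite -scalemxAl mul_delta_mx_cond; case: eqP => _; first by rewrite mulr1n.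
by rewrite mulr0n (scaler0 _ y).
Qed.

(** The real second derivative of the Hermitian form c along v and w is
    B v w + B w v, of which dz dzbar retains the first term; the part h, seen on
    the axis p only, adds to the entry (p, p). *)
Lemma dz_dzbar_of_rays j k : dz j (dzbar k g) 0 =
  c j k + x * ((j == p)%:R * (k == p)%:R) * dz p (dzbar p h) 0.
Proof.
pose L : {linear V -> V} := mulmxr (delta_mx p p).
have E (y z : C) : rderive (y *: delta_mx 0 j) (rderive (z *: delta_mx 0 k) g) 0 =
    x * (if j == p then if k == p then 1 else 0 else 0)
      * rderive (y *: delta_mx 0 p) (rderive (z *: delta_mx 0 p) h) 0
    + (c j k * (y * z^*) + c k j * (z * y^*)).
  rewrite (@rderive2_of_rays R n U U' g h x L Q oU U0 g2 oU' U'0 h2 TQ) polarization !sesqui_delta.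
  rewrite (delta_proj y j : L _ = _) (delta_proj z k : L _ = _).
  apply: (congr1 (fun a => a + _)); case: ifP => _; last first.
    by rewrite rderive0 mulr0 mul0r.
  case: ifP => _; first by rewrite mulr1.
  rewrite (_ : rderive _ h = fun=> 0); first by rewrite rderive_cst mulr0 mul0r.
  by apply: funext => u; rewrite rderive0.
have := E 1 1; have := E 1 'i%C; have := E 'i%C 1; have := E 'i%C 'i%C.
rewrite (scale1r (delta_mx 0 j)) (scale1r (delta_mx 0 k)) (scale1r (delta_mx 0 p)).
move=> E4 E3 E2 E1.
have -> : (j == p)%:R * (k == p)%:R = if j == p then if k == p then 1 else 0 else 0 :> C.
  by case: (j == p); case: (k == p); rewrite /= ?mul1r ?mul0r.
rewrite (dz_dzbarE j k U0 g2) (dz_dzbarE p p U'0 h2).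
exact: (wirtinger_combination E1 E2 E3 E4).
Qed.

End Wirtinger.

(** * The blowdown map in an affine chart *)

Section BlowupChart.
Local Open Scope ring_scope.
Variables (R : realType) (n : nat).
Notation C := R[i].
Notation V := 'rV[C]_n.
Variable p : 'I_n.
Implicit Types (u v w : V) (j k l m a b : 'I_n).

(** The point (y, 1) of C^n when p is the last index: slot p of u holds the
    coordinate s along the fibre, the other slots hold y. *)
Definition affine_lift u : V := \row_j if j == p then 1 else u 0 j.
Definition blowdown u : V := u 0 p *: affine_lift u.
Definition blowdown_jac u : 'M[C]_n :=
  \matrix_(l, a) if l == p then affine_lift u 0 a else (l == a)%:R * u 0 p.

(** The matrix of tau: the identity outside of the slot p. *)
Definition horizontal l m : C := ((l == m) && (l != p))%:R.

(** The linear part K (u) of the Jacobian, see blowdown_jac_ray. *)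
Definition jac_slope u l a : C :=
  (l == p)%:R * ((a != p)%:R * u 0 a) + horizontal l a * u 0 p.

Lemma blowdown_jac_ray u (s : R) l a :
  blowdown_jac (s%:C *: u) l a = ((l == p) && (a == p))%:R + s%:C * jac_slope u l a.
Proof.
rewrite /blowdown_jac /affine_lift /jac_slope /horizontal !mxE.
case: (eqVneq l p) => [->|lp] /=.
  case: (eqVneq a p) => [->|ap] /=; first ring.
  ring.
by rewrite andbT; move: (_ == _)%:R (_ != _)%:R (u 0 a) (u 0 p) => x y z t; ring.
Qed.

Lemma blowdown_ray u (s : R) : blowdown (s%:C *: u) =
  s%:C *: (u *m delta_mx p p) + (s ^+ 2)%:C *: (u 0 p *: \row_j if j == p then 0 else u 0 j).
Proof.
apply/rowP => j; rewrite !mxE (bigD1 p)//= big1 ?addr0.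
  rewrite !mxE eqxx andTb rmorphXn /=; by case: (j == p) => /=; ring.
by move=> i /negPf ip; rewrite !mxE ip andFb mulr0.
Qed.

Lemma sum_delta a (F : 'I_n -> C) : \sum_b (a == b)%:R * F b = F a.
Proof.
rewrite (bigD1 a)//= eqxx mul1r big1 ?addr0// => b; rewrite eq_sym => /negPf->.
by rewrite mul0r.
Qed.

Lemma conjC_real (s : R) : (s%:C)^* = s%:C.
Proof. exact: conjc_real. Qed.

Lemma cvg_sum_complex (I : Type) (r : seq I) (F : set_system R) {FF : Filter F}
    (f : I -> R -> C) (c : I -> C) :
    (forall i, f i s @[s --> F] --> c i) ->
  \sum_(i <- r) f i s @[s --> F] --> \sum_(i <- r) c i.
Proof.
by move=> fc; apply: cvg_big => [|i _]; [exact: add_continuous|exact: fc].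
Qed.

Section Pullback.
Variables (H : V -> 'M[C]_n) (U : set V).
Hypotheses (oU : open U) (U0 : U 0).
Hypothesis H1 : forall a b, Ck 1 U (fun x => H x a b).
Hypothesis H0 : forall a b, H 0 a b = (a == b)%:R.
Hypothesis dH : forall a b v, rderive v (fun x => H x a b) 0 = 0.

Definition pullback_coef u l m :=
  \sum_a \sum_b blowdown_jac u l a * H (blowdown u) a b * (blowdown_jac u m b)^*.

Lemma pullback_coef0 l m : pullback_coef 0 l m = ((l == p) && (m == p))%:R.
Proof.
rewrite /pullback_coef.
have E i a : blowdown_jac 0 i a = ((i == p) && (a == p))%:R.
  by rewrite -(scale0r (0 : V)) (blowdown_jac_ray 0 0) mul0r addr0.
have -> : blowdown 0 = 0 by rewrite /blowdown mxE scale0r.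
under eq_bigr => a _ do
  (under eq_bigr => b _ do rewrite H0 !E mulrAC mulrC conjC_nat; rewrite sum_delta -natrM mulnb).
rewrite (bigD1 p)//= !eqxx !andbT big1 ?addr0// => a /negPf->.
by rewrite andbF.
Qed.

(** The image of a ray is a curve tangent to the axis p, and H - 1 vanishes to
    second order. *)
Lemma blowdown_small u a b :
  (s^-1)%:C * (H (blowdown (s%:C *: u)) a b - (a == b)%:R) @[s --> (0 : R)^'+] --> (0 : C).
Proof.
pose q := u *m delta_mx p p.
pose q' := u 0 p *: \row_j if j == p then 0 else u 0 j.
have A := @shear R n U (fun x => H x a b) q q' oU U0 (@H1 a b) (dH a b q').
have B := first_difference (Ck1_rderivable q (@H1 a b) U0); rewrite dH in B.
have : s%:C * ((s ^- 2)%:C * (H (s%:C *: q + (s ^+ 2)%:C *: q') a b - H (s%:C *: q) a b))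
  + (s^-1)%:C * (H (s%:C *: q) a b - H 0 a b) @[s --> (0 : R)^'+] --> 0 * 0 + (0 : C).
  apply: cvgD B; apply: cvgM A; apply: cvg_at_right_filter; exact: real_complex_continuous.
rewrite mulr0 addr0; apply: cvg_trans; apply: near_eq_cvg; near=> s.
have s0 : s != 0 by apply: lt0r_neq0; near: s; exact: nbhs_right_gt.
have E : s%:C * (s ^- 2)%:C = (s^-1)%:C by rewrite -rmorphM /= expr2 invfM mulrA divff// mul1r.
by rewrite blowdown_ray -/q -/q' mulrA E -mulrDr subrKA H0.
Unshelve. all: by end_near. Qed.

(** The last column of the Jacobian is constant; this is what kills the terms of
    order one of the pullback. *)
Lemma jac_slope_p u l : jac_slope u l p = 0.
Proof.
by rewrite /jac_slope eqxx mul0r mulr0 add0r /horizontal; case: (l == p); rewrite /= mul0r.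
Qed.

(** With J = J_0 + s K, H = 1 + F and A' the conjugate transpose of A, the product
    J H J' expands into J_0 J_0' + s (K J_0' + J_0 K') + s^2 K K' + J_0 F J_0' +
    o(s^2).  The second term vanishes by jac_slope_p, and J_0 F J_0' is F_pp on the
    image of the ray, which may be replaced by the axis p thanks to shear. *)
Lemma pullback_ray u l m :
  (s ^- 2)%:C * (pullback_coef (s%:C *: u) l m - pullback_coef 0 l m
    - ((l == p) && (m == p))%:R * (H (s%:C *: (u *m delta_mx p p)) p p - H 0 p p))
  @[s --> (0 : R)^'+] --> \sum_a jac_slope u l a * (jac_slope u m a)^*.
Proof.
pose q := u *m delta_mx p p.
pose q' := u 0 p *: \row_j if j == p then 0 else u 0 j.
pose J i a : C := ((i == p) && (a == p))%:R; pose K i a := jac_slope u i a.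
pose t a b (s : R) : C :=
  (s ^- 2)%:C * (blowdown_jac (s%:C *: u) l a * H (blowdown (s%:C *: u)) a b
   * (blowdown_jac (s%:C *: u) m b)^* - J l a * (a == b)%:R * J m b
   - J l a * J m b * (H (s%:C *: q) a b - (a == b)%:R)).
have t_cvg a b : t a b s @[s --> (0 : R)^'+] --> (a == b)%:R * (K l a * (K m b)^*).
  have A := @shear R n U (fun x => H x a b) q q' oU U0 (@H1 a b) (dH a b q').
  have B := @blowdown_small u a b.
  have orth : (a == b)%:R * (J m b * K l a + J l a * (K m b)^*) = 0.
    case: (eqVneq a b) => [->|_]; last by rewrite mul0r.
    rewrite /J /K; case: (eqVneq b p) => [->|_]; last by rewrite !andbF !mul0r addr0 mulr0.
    by rewrite !jac_slope_p conjC0 !mulr0 addr0 mulr0.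
  have : J l a * J m b
      * ((s ^- 2)%:C * (H (s%:C *: q + (s ^+ 2)%:C *: q') a b - H (s%:C *: q) a b))
     + (J m b * K l a + J l a * (K m b)^*)
      * ((s^-1)%:C * (H (blowdown (s%:C *: u)) a b - (a == b)%:R))
     + K l a * (K m b)^* * ((a == b)%:R
      + s%:C * ((s^-1)%:C * (H (blowdown (s%:C *: u)) a b - (a == b)%:R)))
    @[s --> (0 : R)^'+] --> J l a * J m b * 0 + (J m b * K l a + J l a * (K m b)^*) * 0
     + K l a * (K m b)^* * ((a == b)%:R + 0 * 0).
    apply: cvgD; first apply: cvgD.
    - by apply: cvgM; [exact: cvg_cst | exact: A].
    - by apply: cvgM; [exact: cvg_cst | exact: B].
    - apply: cvgM; first exact: cvg_cst.
      apply: cvgD; first exact: cvg_cst.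
      apply: cvgM; last exact: B.
      apply: cvg_at_right_filter; exact: real_complex_continuous.
  rewrite !mulr0 !add0r addr0 [X in _ --> X -> _]mulrC.
  apply: cvg_trans; apply: near_eq_cvg; near=> s.
  have s0 : s != 0 by apply: lt0r_neq0; near: s; exact: nbhs_right_gt.
  have Jc : (blowdown_jac (s%:C *: u) m b)^* = J m b + s%:C * (K m b)^*.
    by rewrite blowdown_jac_ray rmorphD rmorphM /= conjC_nat conjC_real.
  rewrite /t -blowdown_ray Jc blowdown_jac_ray -/(J l a) -/(K l a).
  have -> : (s ^- 2)%:C = (s^-1)%:C ^+ 2 by rewrite -rmorphXn /= exprVn.
  have : s%:C * (s^-1)%:C = 1 by rewrite -rmorphM /= divff.
  move: orth (s%:C) (s^-1)%:C (H _ a b) (H _ a b) => + r c hq h.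
  move: (J l a) (J m b) (K l a) (K m b)^* (a == b)%:R => x y z w d orth cs.
  (* The term of order s^-1 carries the factor orth, hence can be subtracted. *)
  transitivity (c ^+ 2 * x * y * (h - hq) + c * h * (y * z + x * w)
    + z * w * (d + (r * c) * (h - d)) - c * (d * (y * z + x * w))).
    by ring.
  transitivity (c ^+ 2 * x * y * (h - hq) + (r * c) * c * h * (y * z + x * w)
    + (r * c) ^+ 2 * z * w * h); last by ring.
  by rewrite orth cs; ring.
have lim : \sum_a \sum_b t a b s @[s --> (0 : R)^'+] -->
    \sum_a jac_slope u l a * (jac_slope u m a)^*.
  have -> : \sum_a jac_slope u l a * (jac_slope u m a)^* =
      \sum_a \sum_b (a == b)%:R * (K l a * (K m b)^*).
    by apply: eq_bigr => a _; rewrite sum_delta.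
  by apply: cvg_sum_complex => a; apply: cvg_sum_complex => b; exact: t_cvg.
have JJ (F : 'I_n -> 'I_n -> C) :
    \sum_a \sum_b J l a * J m b * F a b = ((l == p) && (m == p))%:R * F p p.
  rewrite (bigD1 p)//= [X in _ + X]big1 ?addr0; last first.
    by move=> a /negPf ap; rewrite big1// => b _; rewrite /J ap andbF !mul0r.
  rewrite (bigD1 p)//= big1 ?addr0; first by rewrite /J !eqxx !andbT -natrM mulnb.
  by move=> b /negPf bp; rewrite /J bp andbF mulr0 mul0r.
move: lim; apply: cvg_trans; apply: near_eq_cvg; near=> s.
have JJs : _ = _ * (H (s%:C *: q) p p - (p == p)%:R) :=
  JJ (fun a b => H (s%:C *: q) a b - (a == b)%:R).
rewrite pullback_coef0 /t /pullback_coef H0 -/q -JJs.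
under eq_bigr do rewrite -mulr_sumr.
rewrite -mulr_sumr; apply: (congr1 (fun x => _ * x)).
under eq_bigr do rewrite !sumrB.
rewrite !sumrB; apply: (congr1 (fun x => x - _)); apply: (congr1 (fun x => _ - x)).
under eq_bigr do (under eq_bigr do rewrite mulrAC).
by rewrite JJ eqxx mulr1.
Unshelve. all: by end_near. Qed.

End Pullback.

End BlowupChart.

(** * The Fubini-Study form in an affine chart *)

Section FubiniStudy.
Local Open Scope ring_scope.
Variables (R : realType) (n : nat).
Notation C := R[i].
Notation V := 'rV[C]_n.
Variable p : 'I_n.
Implicit Types (u v w : V) (j k : 'I_n).

Lemma sqnormE w : (sqnorm w)%:C = \sum_j w 0 j * (w 0 j)^*.
Proof.
rewrite /sqnorm rmorph_sum; apply: eq_bigr => j _.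
by rewrite /= add_Re2_Im2 normCK.
Qed.

Notation S u := (sqnorm (affine_lift p u)).

(** The Hermitian product of the y-coordinates, in which log (1 + |y|^2) is the
    potential of b. *)
Definition vertical_dot u v : C := \sum_j (j != p)%:R * (u 0 j * (v 0 j)^*).

Lemma vertical_dot_delta (y : C) k u :
  vertical_dot (y *: delta_mx 0 k) u = (k != p)%:R * (y * (u 0 k)^*).
Proof.
rewrite /vertical_dot (bigD1 k)//= big1 ?addr0; first by rewrite !mxE !eqxx mulr1.
by move=> j /negPf jk; rewrite !mxE jk andbF mulr0 mul0r mulr0.
Qed.

Lemma vertical_dot_delta1 k u : vertical_dot (delta_mx 0 k) u = (k != p)%:R * (u 0 k)^*.
Proof. by rewrite -(scale1r (delta_mx 0 k)) vertical_dot_delta mul1r. Qed.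

(** The slot p of the lift contributes 1. *)
Lemma sqnorm_lift u : (S u)%:C = 1 + vertical_dot u u.
Proof.
rewrite sqnormE /vertical_dot (bigD1 p)//= !mxE eqxx conjC1 mulr1; congr (_ + _).
rewrite [RHS](bigD1 p)//= eqxx mul0r add0r; apply: eq_bigr => j jp.
by rewrite jp mul1r !mxE (negPf jp).
Qed.

Lemma sqnorm_lift_gt0 u : 0 < S u.
Proof.
rewrite -ltcR sqnorm_lift; apply: ltr_pwDl => //; apply: sumr_ge0 => j _.
by rewrite mulr_ge0 ?ler0n// mul_conjC_ge0.
Qed.

Lemma Re_add_conjK (z : C) : (complex.Re (z + z^*))%:C = z + z^*.
Proof. by case: z => a b; apply/eqP; rewrite eq_complex /= subrr !eqxx. Qed.

Lemma is_derive_sqnorm_lift u v :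
  is_derive (0 : R) 1 (fun s => S (u + s%:C *: v))
    (complex.Re (vertical_dot v u + (vertical_dot v u)^*)).
Proof.
have [] // : cderive (fun s => (S (u + s%:C *: v))%:C)
  (vertical_dot v u + (vertical_dot v u)^*).
under eq_fun do rewrite sqnorm_lift.
rewrite -[X in cderive _ X]add0r; apply: cderiveD; first exact: cderive_cst.
rewrite /vertical_dot rmorph_sum -big_split; apply: cderive_sum => j.
apply: cderive_eq.
  apply: cderiveZ; under eq_fun do rewrite mxE mxE.
  apply: cderiveM; last apply: cderive_conj; exact: cderive_affine.
rewrite /= rmorph0 mul0r addr0 !rmorphM /= conjC_nat conjCK mulrDr; congr (_ + _).
by rewrite [X in _ = _ * X]mulrC.
Qed.

Notation pot := (fun u => (ln (S u))%:C).

Lemma rderive_potential v u :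
  rderive v pot u = (vertical_dot v u + (vertical_dot v u)^*) / (S u)%:C.
Proof.
apply: rderiveE.
rewrite -Re_add_conjK -fmorphV -rmorphM; apply: cderive_real => /=.
have D := is_derive_sqnorm_lift u v.
have E : S (u + 0%:C *: v) = S u by rewrite scale0r addr0.
have L := @is_derive1_ln R (S u) (sqnorm_lift_gt0 u); rewrite -E in L.
have := @is_derive1_comp R (@ln R) (fun s => S (u + s%:C *: v)) 0 _ _ L D.
by rewrite E mulrC.
Qed.

Lemma dzbar_potential k u : dzbar k pot u = (k != p)%:R * u 0 k / (S u)%:C.
Proof.
rewrite /dzbar !rderive_potential vertical_dot_delta1 !vertical_dot_delta.
rewrite !rmorphM /= conjC_nat conjCK conj_i.
move: (k != p)%:R (u 0 k) (u 0 k)^* (S u)%:C^-1 => d x y z.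
have -> : 2^-1 * ((d * y + d * x) * z + 'i%C * ((d * ('i%C * y) + d * (- 'i%C * x)) * z)) =
  2^-1 * d * z * (y + x + ('i%C * 'i%C) * (y - x)) by ring.
by rewrite i_mul_i; field.
Qed.

Lemma rderive_dzbar_potential v k u :
  rderive v (dzbar k pot) u = (k != p)%:R * (v 0 k / (S u)%:C
    - u 0 k * (vertical_dot v u + (vertical_dot v u)^*) / (S u)%:C ^+ 2).
Proof.
have -> : dzbar k pot = fun u => (k != p)%:R * (u 0 k * (S u)^-1%:C).
  by apply: funext => x; rewrite dzbar_potential mulrA fmorphV.
apply: rderiveE; apply: cderiveZ.
have E : S (u + 0%:C *: v) = S u by rewrite scale0r addr0.
have Sn0 : S (u + 0%:C *: v) != 0 by apply: lt0r_neq0; exact: sqnorm_lift_gt0.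
have D := cderive_real (is_deriveV Sn0 (is_derive_sqnorm_lift u v)).
apply: cderive_eq.
  apply: cderiveM D; by under eq_fun do rewrite mxE mxE; exact: cderive_affine.
have -> : (- S (u + 0%:C *: v) ^- 2 *: complex.Re (vertical_dot v u + (vertical_dot v u)^*))%:C
    = - (S u)%:C ^- 2 * (vertical_dot v u + (vertical_dot v u)^*).
  by rewrite E -[X in _ = _ * X]Re_add_conjK -rmorphXn -fmorphV -rmorphN -rmorphM.
rewrite E (scale0r v) (addr0 u) fmorphV mulNr mulrN; apply: (congr1 (fun x => _ - x)).
by rewrite mulrCA mulrC.
Qed.

(** The Fubini-Study metric on the affine chart [y : 1], extended by 0 in the
    slot p. *)
Definition fubini_study_coef u j k : C :=
  horizontal R p j k / (S u)%:C
  - (j != p)%:R * (k != p)%:R * ((u 0 j)^* * u 0 k) / (S u)%:C ^+ 2.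

Lemma dz_dzbar_potential j k u : dz j (dzbar k pot) u = fubini_study_coef u j k.
Proof.
have E1 : (k == j) = (j == k) by rewrite eq_sym.
rewrite /dz !rderive_dzbar_potential vertical_dot_delta1 !vertical_dot_delta !mxE eqxx /= E1.
rewrite !rmorphM /= !conjC_nat conjCK conj_i /fubini_study_coef /horizontal.
have -> : ((j == k) && (j != p))%:R = (j == k)%:R * (k != p)%:R :> C.
  by case: eqP => [->|_]; rewrite ?mul1r ?mul0r.
move: (k != p)%:R (j != p)%:R (j == k)%:R (u 0 j) (u 0 j)^* (u 0 k).
move: (S u)%:C^-1 ((S u)%:C ^+ 2)^-1 => z q d e c x y w.
have -> : 2^-1 * (d * (c * z - w * (e * y + e * x) * q) -
    'i%C * (d * ('i%C * c * z - w * (e * ('i%C * y) + e * (- 'i%C * x)) * q))) =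
  2^-1 * d * (c * z * (1 - 'i%C * 'i%C) - w * e * q * (y + x - 'i%C * 'i%C * (y - x))) by ring.
by rewrite i_mul_i; field.
Qed.

Lemma fubini_study_coef0 j k : fubini_study_coef 0 j k = horizontal R p j k.
Proof.
rewrite /fubini_study_coef sqnorm_lift /vertical_dot big1 => [|i _]; last by rewrite mxE mul0r mulr0.
by rewrite addr0 divr1 !mxE mulr0 mulr0 mul0r subr0.
Qed.

(** From 1 / (1 + s^2 r) = 1 - s^2 r / (1 + s^2 r). *)
Lemma fubini_study_ray u j k :
  (s ^- 2)%:C * (fubini_study_coef (s%:C *: u) j k - fubini_study_coef 0 j k) @[s --> (0 : R)^'+] -->
  - (horizontal R p j k * vertical_dot u u + (j != p)%:R * (k != p)%:R * ((u 0 j)^* * u 0 k)).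
Proof.
pose r := vertical_dot u u; pose T := horizontal R p j k.
pose q := (j != p)%:R * (k != p)%:R * ((u 0 j)^* * u 0 k).
have E s : (S (s%:C *: u))%:C = 1 + (s%:C) ^+ 2 * r.
  rewrite sqnorm_lift; congr (_ + _); rewrite /r /vertical_dot mulr_sumr; apply: eq_bigr => i _.
  by rewrite !mxE rmorphM /= conjC_real; ring.
have limS : (S (s%:C *: u))%:C @[s --> (0 : R)^'+] --> (1 : C).
  have : 1 + (s%:C * s%:C) * r @[s --> (0 : R)^'+] --> (1 : C) + (0 * 0) * r.
    apply: cvgD; first exact: cvg_cst.
    apply: cvgM; last exact: cvg_cst.
    by apply: cvgM; apply: cvg_at_right_filter; exact: real_complex_continuous.
  rewrite (mul0r (0 : C)) (mul0r r) (addr0 (1 : C)).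
  by under [X in _ -> X]eq_cvg do rewrite E expr2.
have limV : ((S (s%:C *: u))%:C)^-1 @[s --> (0 : R)^'+] --> (1 : C).
  by rewrite -[X in _ --> X]invr1; exact: cvgV (oner_neq0 _) limS.
have : - (T * r * ((S (s%:C *: u))%:C)^-1
    + q * (((S (s%:C *: u))%:C)^-1 * ((S (s%:C *: u))%:C)^-1))
   @[s --> (0 : R)^'+] --> - (T * r * 1 + q * (1 * 1)).
  apply: cvgN; apply: cvgD.
    by apply: cvgM; [exact: cvg_cst|exact: limV].
  by apply: cvgM; [exact: cvg_cst|apply: cvgM; exact: limV].
rewrite (mulr1 (1 : C)) (mulr1 (T * r)) (mulr1 q); apply: cvg_trans; apply: near_eq_cvg; near=> s.
have s0 : s != 0 by apply: lt0r_neq0; near: s; exact: nbhs_right_gt.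
have Sn0 : (S (s%:C *: u))%:C != 0.
  by rewrite fmorph_eq0; apply: lt0r_neq0; exact: sqnorm_lift_gt0.
rewrite fubini_study_coef0 /fubini_study_coef !mxE rmorphM /= conjC_real -/T -/q.
have -> : (s ^- 2)%:C = (s^-1)%:C ^+ 2 by rewrite -rmorphXn /= exprVn.
have : s%:C * (s^-1)%:C = 1 by rewrite -rmorphM /= divff.
move: Sn0; rewrite E /q.
move: (s%:C) (s^-1)%:C (u 0 j)^* (u 0 k) (_ != _)%:R (_ != _)%:R => a b x y d e Sn0 ab.
have -> : b ^+ 2 * (T / (1 + a ^+ 2 * r)
      - e * d * (a * x * (a * y)) / (1 + a ^+ 2 * r) ^+ 2 - T)
  = (a * b) ^+ 2 * - (T * r / (1 + a ^+ 2 * r)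
      + e * d * (x * y) * ((1 + a ^+ 2 * r)^-1 / (1 + a ^+ 2 * r))).
  by field.
by rewrite ab expr1n mul1r.
Unshelve. all: by end_near. Qed.

End FubiniStudy.

(** * Curvature coefficients of the blown-up metric *)

Section BlowupCurvature.
Local Open Scope ring_scope.
Variables (R : realType) (n : nat).
Notation C := R[i].
Notation V := 'rV[C]_n.
Variable p : 'I_n.
Variables (G H : V -> 'M[C]_n) (U U' : set V) (t : C).
Hypotheses (oU : open U) (U0 : U 0) (oU' : open U') (U'0 : U' 0).
Hypothesis G2 : forall a b, Ck 2 U (fun x => G x a b).
Hypothesis H2 : forall a b, Ck 2 U' (fun x => H x a b).
Hypothesis H0 : forall a b, H 0 a b = (a == b)%:R.
Hypothesis dH : forall a b v, rderive v (fun x => H x a b) 0 = 0.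
Hypothesis GE : forall u, U u -> forall l m,
  G u l m = pullback_coef p H u l m + t * fubini_study_coef p u l m.
Implicit Types j k l m : 'I_n.

Notation T := (horizontal R p).
Notation e j := ((j == p)%:R : C).

(** The coefficient of u_j conj(u_k) in the Hermitian quadratic form which is the
    part of order two of the metric coefficient of index (l, m), apart from H_pp. *)
Definition metric_hessian l m j k : C :=
  e j * e k * T l m + e j * e m * T l k + e l * e k * T j m + e l * e m * T j k
  - t * (T j k * T l m + T j m * T l k).

Lemma sum_sep (f g : 'I_n -> C) (u v : V) :
  \sum_j \sum_k f j * g k * (u 0 j * (v 0 k)^*) = (\sum_j f j * u 0 j) * (\sum_k g k * (v 0 k)^*).
Proof.
rewrite mulr_suml; apply: eq_bigr => j _; rewrite mulr_sumr; apply: eq_bigr => k _.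
by rewrite !mulrA; congr (_ * _); rewrite mulrAC.
Qed.

Lemma sum_horizontal l (f : 'I_n -> C) : \sum_k T l k * f k = (l != p)%:R * f l.
Proof.
rewrite (bigD1 l)//= big1 ?addr0 => [|k kl]; first by rewrite /horizontal eqxx.
by rewrite /horizontal eq_sym (negPf kl) mul0r.
Qed.

Lemma horizontalC l m : T l m = T m l.
Proof. by rewrite /horizontal eq_sym; case: eqP => [->|]. Qed.

Lemma sum_select (f : 'I_n -> C) : \sum_k e k * f k = f p.
Proof. by under eq_bigr do rewrite eq_sym; rewrite sum_delta. Qed.

Lemma sum_metric_hessian (u : V) l m :
  \sum_j \sum_k metric_hessian l m j k * (u 0 j * (u 0 k)^*) =
  \sum_a jac_slope p u l a * (jac_slope p u m a)^*
  + t * - (T l m * vertical_dot p u u + (l != p)%:R * (m != p)%:R * ((u 0 l)^* * u 0 m)).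
Proof.
have TT : \sum_j \sum_k T j k * (u 0 j * (u 0 k)^*) = vertical_dot p u u.
  apply: eq_bigr => j _; exact: sum_horizontal.
have -> : \sum_j \sum_k metric_hessian l m j k * (u 0 j * (u 0 k)^*) =
    T l m * (\sum_j \sum_k e j * e k * (u 0 j * (u 0 k)^*))
  + e m * (\sum_j \sum_k e j * T l k * (u 0 j * (u 0 k)^*))
  + e l * (\sum_j \sum_k T m j * e k * (u 0 j * (u 0 k)^*))
  + e l * e m * (\sum_j \sum_k T j k * (u 0 j * (u 0 k)^*))
  - t * (T l m * (\sum_j \sum_k T j k * (u 0 j * (u 0 k)^*))
         + \sum_j \sum_k T m j * T l k * (u 0 j * (u 0 k)^*)).
  rewrite !mulr_sumr -!big_split /= mulr_sumr -sumrB; apply: eq_bigr => j _.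
  rewrite !mulr_sumr -!big_split /= mulr_sumr -sumrB; apply: eq_bigr => k _.
  by rewrite /metric_hessian (horizontalC m j); ring.
rewrite TT !sum_sep !sum_select !sum_horizontal.
have -> : \sum_a jac_slope p u l a * (jac_slope p u m a)^* =
   e l * e m * vertical_dot p u u + e l * ((m != p)%:R * u 0 m * (u 0 p)^*)
   + e m * ((l != p)%:R * (u 0 l)^* * u 0 p) + T l m * (u 0 p * (u 0 p)^*).
  transitivity (\sum_a (e l * e m * ((a != p)%:R * (u 0 a * (u 0 a)^*))
     + e l * (u 0 p)^* * (T m a * ((a != p)%:R * u 0 a))
     + e m * u 0 p * (T l a * ((a != p)%:R * (u 0 a)^*))
     + u 0 p * (u 0 p)^* * (T l a * T m a))).
    apply: eq_bigr => a _; rewrite /jac_slope !rmorphD !rmorphM /= !conjC_nat.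
    rewrite -/(T m a).
    have dd : (a != p)%:R * (a != p)%:R = (a != p)%:R :> C by rewrite -natrM mulnb andbb.
    move: (a != p)%:R (T m a) (T l a) (e l) (e m) (u 0 a) (u 0 a)^* (u 0 p) (u 0 p)^* dd.
    move=> d x y z w a1 a2 p1 p2 dd.
    transitivity (z * w * (d * d * (a1 * a2)) + z * p2 * (x * (d * a1))
      + w * p1 * (y * (d * a2)) + p1 * p2 * (y * x)); first by ring.
    by rewrite dd.
  rewrite !big_split /= -!mulr_sumr !sum_horizontal -/(vertical_dot p u u).
  have -> : (l != p)%:R * T m l = T l m.
    rewrite /horizontal (eq_sym l m); case: (eqVneq m l) => [->|_] /=; last by rewrite mulr0.
    by rewrite -natrM mulnb andbb.
  have sq i (x : C) : (i != p)%:R * ((i != p)%:R * x) = (i != p)%:R * x.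
    by rewrite mulrA -natrM mulnb andbb.
  by rewrite !sq; ring.
by ring.
Qed.

Lemma metric_ray l m u :
  (s ^- 2)%:C * (G (s%:C *: u) l m - G 0 l m
    - (e l * e m) * (H (s%:C *: (u *m delta_mx p p)) p p - H 0 p p))
  @[s --> (0 : R)^'+] --> \sum_j \sum_k metric_hessian l m j k * (u 0 j * (u 0 k)^*).
Proof.
rewrite sum_metric_hessian.
have A := @pullback_ray R n p H U' oU' U'0 (fun a b => Ck2_Ck1 (H2 a b)) H0 dH u l m.
have B := @fubini_study_ray R n p u l m.
have : (s ^- 2)%:C * (pullback_coef p H (s%:C *: u) l m - pullback_coef p H 0 l m
    - ((l == p) && (m == p))%:R * (H (s%:C *: (u *m delta_mx p p)) p p - H 0 p p))
    + t * ((s ^- 2)%:C * (fubini_study_coef p (s%:C *: u) l m - fubini_study_coef p 0 l m))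
    @[s --> (0 : R)^'+] -->
   \sum_a jac_slope p u l a * (jac_slope p u m a)^*
  + t * - (T l m * vertical_dot p u u + (l != p)%:R * (m != p)%:R * ((u 0 l)^* * u 0 m)).
  by apply: cvgD; [exact: A|apply: cvgM; [exact: cvg_cst|exact: B]].
apply: cvg_trans; apply: near_eq_cvg; near=> s.
have Us : U (s%:C *: u).
  near: s; exact: (cvg_at_right_filter (@cvg_ray0 R n u) (open_nbhs_nbhs (conj oU U0))).
rewrite (GE Us) (GE U0) -natrM mulnb.
move: (s ^- 2)%:C (pullback_coef _ _ _ _ _) (pullback_coef _ _ _ _ _).
move: (fubini_study_coef _ _ _ _) (fubini_study_coef _ _ _ _) (H _ _ _) (H _ _ _) (_ && _)%:R.
move=> y1 y2 h1 h2 d c x1 x2.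
by ring.
Unshelve. all: by end_near. Qed.

Lemma dz_metric0 j l m : dz j (fun u => G u l m) 0 = 0.
Proof.
have E v : rderive v (fun u => G u l m) 0 = 0.
  rewrite (@rderive_of_rays R n U U' _ (fun u => H u p p) (e l * e m) (mulmxr (delta_mx p p)) _
    U0 (G2 l m) U'0 (H2 p p) (@metric_ray l m)).
  by rewrite dH mulr0.
by rewrite /dz !E mulr0 subr0 mulr0.
Qed.

Lemma dz_dzbar_metric j k l m : dz j (dzbar k (fun u => G u l m)) 0 =
  metric_hessian l m j k + e l * e m * (e j * e k) * dz p (dzbar p (fun u => H u p p)) 0.
Proof.
exact: (@dz_dzbar_of_rays R n (metric_hessian l m) p U U' (fun u => G u l m) (fun u => H u p p)
  (e l * e m) oU U0 (G2 l m) oU' U'0 (H2 p p) (@metric_ray l m)).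
Qed.

(** In normal coordinates the first order terms of the curvature vanish. *)
Lemma curv_coef_normal j k l m : curv_coef H 0 j k l m = - dz j (dzbar k (fun u => H u l m)) 0.
Proof.
rewrite /curv_coef big1 ?addr0// => a _; rewrite big1// => b _.
by rewrite {1}/dz !dH mulr0 subr0 mulr0 mulr0 mul0r.
Qed.

Lemma curv_coef_blowup j k l m : curv_coef G 0 j k l m =
  e j * e k * e l * e m * curv_coef H 0 p p p p + t * (T j k * T l m + T j m * T l k)
  - e j * e k * T l m - e j * e m * T l k - e l * e k * T j m - e l * e m * T j k.
Proof.
rewrite curv_coef_normal /curv_coef dz_dzbar_metric big1 => [|a _]; last first.
  by rewrite big1// => b _; rewrite dz_metric0 mulr0 mul0r.
by rewrite /metric_hessian; ring.
Qed.

End BlowupCurvature.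

(** * Differentials and Jacobians *)

Section Jacobians.
Local Open Scope ring_scope.
Variable K : numFieldType.

Lemma near_diff (V W : normedModType K) (f g : V -> W) (x : V) :
    (\forall y \near x, f y = g y) -> differentiable f x ->
  differentiable g x /\ 'd g x = 'd f x :> (V -> W).
Proof.
move=> fg df; have fgx : f x = g x := nbhs_singleton fg.
have cf : continuous ('d f x) by exact: diff_continuous.
have E : g \o shift x = cst (g x) + 'd f x +o_ (0 : V) id.
  have /eqaddoP H := diff_locally df; apply/eqaddoP => e /H.
  have : \forall z \near (0 : V), f (z + x) = g (z + x).
    by move: fg; rewrite (near_shift 0 x); apply: filterS => z /=; rewrite subr0.
  apply: filterS2 => y /= E.
  by rewrite !fctE /= -E -fgx.
have D := diff_unique cf E.
have dg : differentiable g x by apply/diff_locallyP; rewrite D; exact: conj cf E.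
exact: (conj dg D).
Qed.

Lemma near_jacobian m n (f g : 'rV[K]_m -> 'rV[K]_n) x :
    (\forall y \near x, f y = g y) -> differentiable f x -> 'J g x = 'J f x.
Proof.
move=> fg df; have [_ D] := near_diff fg df.
exact: (congr1 (fun F => lin1_mx F) D).
Qed.

Lemma mulmx_jacobian m n (f : 'rV[K]_m -> 'rV[K]_n) x v : v *m 'J f x = 'd f x v.
Proof. by rewrite mul_rV_lin1. Qed.

Lemma jacobian_comp m n k (f : 'rV[K]_m -> 'rV[K]_n) (g : 'rV[K]_n -> 'rV[K]_k) x :
  differentiable f x -> differentiable g (f x) -> 'J (g \o f) x = 'J f x *m 'J g (f x).
Proof.
move=> df dg; apply/row_matrixP => i.
by rewrite !rowE mulmxA !mulmx_jacobian diff_comp.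
Qed.

Lemma differentiable_rV (V : normedModType K) n (f : V -> 'rV[K]_n) x :
  (forall j, differentiable (fun y => f y 0 j) x) -> differentiable f x.
Proof.
move=> df; have -> : f = \sum_j (fun y => f y 0 j *: delta_mx 0 j).
  apply: funext => y; rewrite fct_sumE.
  by rewrite {1}(row_sum_delta (f y)).
by apply: differentiable_sum => j; exact: differentiableZl.
Qed.

Lemma is_diff_coord n (u : 'rV[K]_n) j :
  is_diff u (fun v : 'rV[K]_n => v 0 j : K^o) (fun v => v 0 j).
Proof.
have lin : linear (fun v : 'rV[K]_n => v 0 j : K^o) by move=> a x y; rewrite !mxE.
pose c : {linear 'rV[K]_n -> K^o} := HB.pack (fun v : 'rV[K]_n => v 0 j : K^o)
  (GRing.isLinear.Build _ _ _ _ _ lin).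
have cc : continuous c by exact: coord_continuous.
by apply: DiffDef; [exact: (linear_differentiable (f := c))|exact: (diff_lin (f := c))].
Qed.

(** Reduces the computation of Jacobians to scalar functions. *)
Lemma diff_rV (V : normedModType K) n (f : V -> 'rV[K]_n) x v j :
  differentiable f x -> 'd f x v 0 j = 'd (fun y => f y 0 j) x v.
Proof.
move=> df; have [dc E] := is_diff_coord (f x) j.
rewrite (_ : (fun y => f y 0 j) = (fun M : 'rV[K]_n => M 0 j) \o f)//.
by rewrite (diff_comp df dc) E.
Qed.

Lemma jacobian_rV m n (f : 'rV[K]_m -> 'rV[K]_n) x i j :
  differentiable f x -> 'J f x i j = 'd (fun y => f y 0 j) x (delta_mx 0 i).
Proof. by move=> df; rewrite mxE diff_rV. Qed.

Lemma mulmxr_continuous m n (M : 'M[K]_(m, n)) : continuous (mulmxr M : 'rV[K]_m -> 'rV[K]_n).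
Proof.
move=> x; apply: differentiable_continuous; apply: differentiable_rV => j.
rewrite (_ : (fun y => _) = \sum_i (fun y : 'rV[K]_m => y 0 i * M i j)).
  apply: differentiable_sum => i; apply: differentiableM; first exact: differentiable_coord.
  exact: differentiable_cst.
by apply: funext => y; rewrite fct_sumE mxE.
Qed.

Lemma differentiable_mulmxr m n (M : 'M[K]_(m, n)) x : differentiable (fun u : 'rV[K]_m => u *m M) x.
Proof. exact: (linear_differentiable (f := mulmxr M) x (@mulmxr_continuous m n M)). Qed.

Lemma jacobian_mulmxr m n (M : 'M[K]_(m, n)) x : 'J (fun u : 'rV[K]_m => u *m M) x = M.
Proof.
apply/row_matrixP => i; rewrite !rowE mulmx_jacobian.
by rewrite (_ : (fun u => u *m M) = mulmxr M)// diff_lin//; exact: mulmxr_continuous.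
Qed.

End Jacobians.

Section BlowdownJacobian.
Local Open Scope ring_scope.
Variables (R : realType) (n : nat) (p : 'I_n).
Notation C := R[i].
Notation V := 'rV[C]_n.

Lemma is_diff_blowdown (u : V) j : is_diff u (fun v => blowdown p v 0 j)
  (fun v => if j == p then v 0 p else u 0 p * v 0 j + u 0 j * v 0 p).
Proof.
rewrite /blowdown /affine_lift; under eq_fun do rewrite !mxE.
case: eqP => _; first by under eq_fun do rewrite mulr1; exact: is_diff_coord.
exact: (is_diffM (is_diff_coord u p) (is_diff_coord u j)).
Qed.

Lemma differentiable_blowdown (u : V) : differentiable (blowdown p) u.
Proof. by apply: differentiable_rV => j; have [] := is_diff_blowdown u j. Qed.

Lemma jacobian_blowdown (u : V) : 'J (blowdown p) u = blowdown_jac p u.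
Proof.
apply/matrixP => l a; rewrite jacobian_rV; last exact: differentiable_blowdown.
have [_ ->] := is_diff_blowdown u a; rewrite /blowdown_jac /affine_lift !mxE eqxx /=.
rewrite (eq_sym p l) (eq_sym a l).
case: (boolP (l == p)) => [/eqP El|lp]; case: (boolP (a == p)) => [/eqP Ea|ap] //=.
- by rewrite El (eq_sym p a) (negPf ap) mulr0 add0r mulr1.
- by rewrite Ea (negPf lp) mul0r.
- by rewrite mulr0 addr0 mulrC.
Qed.

End BlowdownJacobian.

(** * Sesquilinear forms under changes of chart *)

Section Charts.
Local Open Scope ring_scope.
Variables (R : realType) (n : nat).
Notation C := R[i].
Notation V := 'rV[C]_n.

Lemma cimageP (X : topologicalType) (c : chart R n X) u : is_chart c -> cimage c u ->
  cdom c (cinv c u) /\ c (cinv c u) = u.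
Proof. by move=> [_ _ cK _ _] [x xc <-]; rewrite cK. Qed.

Lemma near_cinv (X : topologicalType) (c : chart R n X) u (A : set X) :
  is_chart c -> cimage c u -> open A -> A (cinv c u) -> \forall v \near u, A (cinv c v).
Proof.
move=> [_ _ _ _ ci] cu oA Au; have := ci _ cu.
by apply; exact: (open_nbhs_nbhs (conj oA Au)).
Qed.

Lemma near_cimage (X : topologicalType) (c : chart R n X) u : is_chart c -> cimage c u ->
  \forall v \near u, cimage c v.
Proof. by move=> [_ oc _ _ _] cu; exact: (open_nbhs_nbhs (conj oc cu)). Qed.

Lemma transition_at (X : topologicalType) (c d : chart R n X) u : transition c d ->
  is_chart c -> cimage c u -> cdom d (cinv c u) -> differentiable (d \o cinv c) u.
Proof.
move=> H ic cu du; apply: H; have [cc E] := cimageP ic cu.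
by exists (cinv c u).
Qed.

Lemma mulmx_conj (A B H : 'M[C]_n) :
  A *m (B *m H *m B ^t*) *m A ^t* = (A *m B) *m H *m (A *m B) ^t*.
Proof. by rewrite trmx_mul map_mxM !mulmxA. Qed.

(** The chain rule for chart_at y o cinv z precomposed with a linear map. *)
Lemma coef_linear (M : cmanifold R n) (h : sform M) (z : chart R n M) (f : 'M[C]_n) x :
    holchart z -> cimage z (x *m invmx f) ->
  coef h (linear_chart z f) x =
    invmx f *m coef h z (x *m invmx f) *m (invmx f) ^t*.
Proof.
move=> [iz tz] zx; pose y := cinv z (x *m invmx f).
have [icy cy] := chart_atP y; have [ty _] := tz y.
have dy : differentiable (chart_at y \o cinv z) (x *m invmx f) := transition_at ty iz zx cy.
have E := jacobian_comp (differentiable_mulmxr (invmx f) x) dy.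
rewrite jacobian_mulmxr in E.
change ('J ((chart_at y \o cinv z) \o (fun u => u *m invmx f)) x *m h y *m
  ('J ((chart_at y \o cinv z) \o (fun u => u *m invmx f)) x) ^t* =
  invmx f *m ('J (chart_at y \o cinv z) (x *m invmx f) *m h y *m
   ('J (chart_at y \o cinv z) (x *m invmx f)) ^t*) *m (invmx f) ^t*).
by rewrite E trmx_mul map_mxM !mulmxA.
Qed.

(** Both sides are conjugates of h (mu x) by the Jacobian at u of
    chart_at (mu x) o mu o cinv c, factored through the preferred chart at x on the
    left and through theta and the chart d on the right. *)
Lemma coef_pullback (M N : cmanifold R n) (mu : M -> N) (h : sform N)
    (c : chart R n M) (d : chart R n N) (theta : V -> V) u :
    holomap_on setT mu -> holchart c -> holchart d -> cimage c u -> cdom d (mu (cinv c u)) ->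
    (\forall v \near u, d (mu (cinv c v)) = theta v) -> differentiable theta u ->
  coef (pullback mu h) c u = 'J theta u *m coef h d (theta u) *m ('J theta u) ^t*.
Proof.
move=> hmu [ic tc] [id' td] cu dmu Etheta dtheta.
have [ccu _] := cimageP ic cu; pose x := cinv c u; pose y := mu x.
have thetau : theta u = d y by rewrite -(nbhs_singleton Etheta).
have dK : cinv d (d y) = y by have [_ _ K _ _] := id'; exact: K.
have Ey : cinv d (theta u) = y by rewrite thetau.
have dy : cimage d (theta u) by rewrite thetau; exists y.
have [icx cx] := chart_atP x; have [icy cy] := chart_atP y.
have [mux dmux] := hmu x I; have [tcx _] := tc x; have [tdy _] := td y.
have cyE : cdom (chart_at y) (cinv d (theta u)) by rewrite Ey.
have d1 : differentiable (chart_at x \o cinv c) u := transition_at tcx ic cu cx.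
have d2 : differentiable (chart_at y \o cinv d) (theta u) := transition_at tdy id' dy cyE.
have E1 := jacobian_comp d1 dmux.
have E2 := jacobian_comp dtheta d2.
have E3 : 'J (local_rep mu x \o (chart_at x \o cinv c)) u =
    'J ((chart_at y \o cinv d) \o theta) u.
  apply: (@near_jacobian _ _ _ ((chart_at y \o cinv d) \o theta)
    (local_rep mu x \o (chart_at x \o cinv c)) u); last exact: (differentiable_comp dtheta d2).
  have ox : open (cdom (chart_at x)) by have [] := icx.
  have od : open (cdom d) by have [] := id'.
  have n1 : \forall v \near u, cdom (chart_at x) (cinv c v) := near_cinv ic cu ox cx.
  have n2 : \forall v \near u, cdom d (mu (cinv c v)).
    have /(mux _) m1 : nbhs (mu x) (cdom d) by exact: (open_nbhs_nbhs (conj od dmu)).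
    have [_ _ _ _ ci] := ic; exact: (ci _ cu _ m1).
  apply: filterS3 n1 n2 Etheta => v c1 c2 E.
  have [_ _ K1 _ _] := id'; have [_ _ K2 _ _] := icx.
  by rewrite /local_rep /= -E (K1 _ c2) (K2 _ c1).
have -> : coef h d (theta u) = 'J (chart_at y \o cinv d) (theta u) *m h y *m
    ('J (chart_at y \o cinv d) (theta u)) ^t* by rewrite /coef Ey.
change ('J (chart_at x \o cinv c) u *m ('J (local_rep mu x) (chart_at x x) *m h y *m
   ('J (local_rep mu x) (chart_at x x)) ^t*) *m ('J (chart_at x \o cinv c) u) ^t* =
  'J theta u *m ('J (chart_at y \o cinv d) (theta u) *m h y *m
    ('J (chart_at y \o cinv d) (theta u)) ^t*) *m ('J theta u) ^t*).
exact: etrans (mulmx_conj _ _ _) (etrans (congr1 (fun M => M *m h y *m M ^t*)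
  (etrans (esym E1) (etrans E3 E2))) (esym (mulmx_conj _ _ _))).
Qed.

Lemma holchart_linear (M : cmanifold R n) (z : chart R n M) (f : 'M[C]_n) : f \in unitmx ->
  holchart z -> holchart (linear_chart z f).
Proof.
move=> uf [iz tz]; have [oz oiz zK zc ziv] := iz.
have cimE : cimage (linear_chart z f) = (fun u => u *m invmx f) @^-1` (cimage z).
  apply/seteqP; split=> u /=; first by move=> [x zx <-]; exists x => //=; rewrite mulmxK.
  by move=> [x zx E]; exists x => //=; rewrite E mulmxKV.
have cont (g : 'M[C]_n) : continuous (fun u : V => u *m g) by exact: mulmxr_continuous.
split; first split.
- exact: oz.
- by rewrite cimE; apply: open_comp => // u _; exact: cont.
- by move=> x zx /=; rewrite mulmxK// zK.
- move=> x zx; apply: (@cvg_comp _ _ _ z (fun u => u *m f) _ _ _ (zc _ zx)); exact: cont.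
- move=> u; rewrite cimE /= => zu.
  exact: (@cvg_comp _ _ _ (fun u => u *m invmx f) (cinv z) (nbhs u)
    (nbhs (u *m invmx f)) _ (@cont (invmx f) u) (ziv _ zu)).
move=> x; have [t1 t2] := tz x; split.
  move=> u [y [zy dy] <-] /=.
  apply: (@differentiable_comp _ _ _ _ (fun u => u *m invmx f) (chart_at x \o cinv z)).
    exact: differentiable_mulmxr.
  by rewrite (mulmxK uf (z y)); apply: t1; exists y.
move=> u [y [zy dy] <-] /=.
apply: (@differentiable_comp _ _ _ _ (z \o cinv (chart_at x)) (fun u => u *m f)).
  by apply: t2; exists y.
exact: differentiable_mulmxr.
Qed.

End Charts.

(** * The chart adapted to a point of the exceptional divisor *)

Section Lines.
Local Open Scope ring_scope.
Variables (K : fieldType) (V : vectType K).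

Lemma dim1_vline (L : {vspace V}) (v : V) : \dim L = 1%N -> v \in L -> v != 0 -> L = <[v]>%VS.
Proof.
move=> dL vL v0; apply/esym/eqP; rewrite eqEdim -memvE vL dim_vline v0 dL //.
Qed.

Lemma vlineZ (k : K) (v : V) : k != 0 -> <[k *: v]>%VS = <[v]>%VS.
Proof.
move=> k0; have [->|v0] := eqVneq v 0; first by rewrite scaler0.
apply: dim1_vline; first by rewrite dim_vline scaler_eq0 negb_or k0 v0.
  by apply/vlineP; exists k^-1; rewrite scalerA mulVf// scale1r.
exact: v0.
Qed.

End Lines.

Section Unitary.
Local Open Scope ring_scope.
Variables (R : realType) (n : nat).
Notation C := R[i].

Lemma invmx_is_unitary (f : 'M[C]_n) : f \is unitarymx -> invmx f *m (invmx f) ^t* = 1%:M.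
Proof. by move=> uf; rewrite invmx_unitary//; apply/unitarymxP; rewrite trmxC_unitary. Qed.

Lemma sqnorm_unitary (f : 'M[C]_n) (v : 'rV[C]_n) : f \is unitarymx ->
  sqnorm (v *m invmx f) = sqnorm v.
Proof.
move=> uf; apply: complexI; rewrite !sqnormE.
have S (u : 'rV[C]_n) : \sum_j u 0 j * (u 0 j)^* = (u *m u ^t*) 0 0.
  by rewrite mxE; apply: eq_bigr => j _; rewrite !mxE.
by rewrite !S trmx_mul map_mxM mulmxA -(mulmxA v) invmx_is_unitary// mulmx1.
Qed.
End Unitary.

Section Adapted.
Local Open Scope ring_scope.
Variables (R : realType) (n : nat).
Notation C := R[i].
Notation V := 'rV[C]_n.+1.
Notation N := (@ord_max n).
Variables (X Xhat : cmanifold R n.+1) (z : chart R n.+1 X) (mu : Xhat -> X)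
  (pi : Xhat -> {vspace V}) (f : 'M[C]_n.+1) (q : Xhat) (psi : chart R n.+1 Xhat).
Hypothesis hinc : forall x, cdom z (mu x) -> \dim (pi x) = 1%N /\ z (mu x) \in pi x.
Hypothesis fu : f \in unitmx.
Hypothesis hpsi : adapted_chart z mu pi f q psi.

Lemma y_coordE x i : y_coord pi f x 0 i =
  (vpick (pi x) *m f) 0 (lift N i) / (vpick (pi x) *m f) 0 N.
Proof. exact: mxE. Qed.

(** The vector chosen on the line pi x, rotated by f, is the multiple of (y, 1)
    given by its last coordinate. *)
Lemma adapted_lift x : cdom psi x ->
  (vpick (pi x) *m f) 0 N != 0 /\
  vpick (pi x) *m f = (vpick (pi x) *m f) 0 N *: affine_lift N (psi x).
Proof.
have [_ _ H] := hpsi; move=> /H[_ vN Hy _]; split=> //.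
apply/rowP => j; rewrite [RHS]mxE [affine_lift _ _ _ _]mxE.
case: (unliftP N j) => [i|] ->; last by rewrite eqxx mulr1.
by rewrite eq_sym (negPf (neq_lift _ _)) Hy y_coordE mulrCA divff// mulr1.
Qed.

Lemma pick_line x : cdom psi x -> pi x = <[vpick (pi x)]>%VS.
Proof.
move=> px; have [_ _ /(_ _ px) [zx vN _ _]] := hpsi.
have [d1 _] := hinc zx; apply: dim1_vline => //; first exact: memv_pick.
by apply: contraNneq vN => ->; rewrite mul0mx mxE.
Qed.

(** Hence u |-> (y, 1) f^-1 is a lift of pi in the adapted chart. *)
Lemma pi_adapted x : cdom psi x -> pi x = <[affine_lift N (psi x) *m invmx f]>%VS.
Proof.
move=> px; have [vN E] := adapted_lift px; rewrite {1}(pick_line px).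
by rewrite -[vpick _](mulmxK fu) E -scalemxAl vlineZ.
Qed.

(** The vector z (mu x) lies on the line pi x, and its last coordinate after
    rotation is s. *)
Lemma adapted_blowdown x : cdom psi x -> linear_chart z f (mu x) = blowdown N (psi x).
Proof.
move=> px; have [_ _ /(_ _ px) [zx vN _ HN]] := hpsi.
have [_] := hinc zx; rewrite {1}(pi_adapted px) => /vlineP[k Ek].
have E : linear_chart z f (mu x) = k *: affine_lift N (psi x).
  by rewrite /= Ek -scalemxAl mulmxKV.
by rewrite E /blowdown HN /x_coord E !mxE eqxx mulr1.
Qed.

(** Over p the fibre coordinate s vanishes, and the choice of f makes [w] the
    origin of the affine chart. *)
Lemma adapted_origin (p : X) (w : V) : mu q = p -> z p = 0 -> pi q = <[w]>%VS ->
  <[w *m f]>%VS = <[(delta_mx 0 N : V)%R]>%VS -> psi q = 0.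
Proof.
move=> hq hz hw hfw; have [_ dq Hp] := hpsi; have [_ vN Hy HN] := Hp _ dq.
have : vpick (pi q) \in <[w]>%VS by rewrite -hw memv_pick.
move=> /vlineP[k Ek].
have : w *m f \in <[(delta_mx 0 N : V)%R]>%VS by rewrite -hfw memv_line.
move=> /vlineP[k' Ek'].
apply/rowP => j; rewrite [RHS]mxE; case: (unliftP N j) => [i|] ->.
  rewrite Hy y_coordE Ek -scalemxAl Ek' !mxE (eq_sym _ N) (negPf (neq_lift _ _)).
  by rewrite andbF !mulr0 mul0r.
by rewrite HN /x_coord /= hq hz mul0mx mxE.
Qed.

Lemma near_adapted u : cimage psi u ->
  \forall v \near u, linear_chart z f (mu (cinv psi v)) = blowdown N v.
Proof.
have [[ip _] _ _] := hpsi; move=> /(near_cimage ip); apply: filterS => v pv.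
by have [cv E] := cimageP ip pv; rewrite adapted_blowdown// E.
Qed.

Lemma differentiable_affine_lift (u : V) : differentiable (affine_lift N : V -> V) u.
Proof.
apply: differentiable_rV => j; rewrite /affine_lift; under eq_fun do rewrite mxE.
by case: eqP => _; [exact: differentiable_cst|exact: differentiable_coord].
Qed.

Lemma affine_lift_neq0 (u : V) : affine_lift N u != 0.
Proof. by apply/eqP => /rowP/(_ N); rewrite !mxE eqxx => /eqP; rewrite oner_eq0. Qed.

(** The lift (y, 1) f^-1 has the same norm as (y, 1), f being unitary. *)
Lemma coef_fubini_study (b : sform Xhat) (W : set Xhat) : f \is unitarymx -> open W ->
    fubini_study_on W pi b ->
  forall u, cimage psi u -> W (cinv psi u) -> forall j k, coef b psi u j k = fubini_study_coef N u j k.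
Proof.
move=> uf oW H u pu Wu j k; have [hp _ _] := hpsi; have [ip _] := hp.
pose Y := cimage psi `&` [set v | W (cinv psi v)].
have oY : open Y.
  rewrite openE => v [pv Wv]; apply: filterI; first exact: near_cimage.
  exact: near_cinv.
have Y1 : Y `<=` cimage psi by move=> v [].
have Y2 v : Y v -> W (cinv psi v) by move=> [].
have Y3 : holomorphic_on Y (fun v => affine_lift N v *m invmx f).
  move=> v _.
  apply: (@differentiable_comp _ _ _ _ (affine_lift N) (fun u => u *m invmx f)).
    exact: differentiable_affine_lift.
  exact: differentiable_mulmxr.
have Y4 v : Y v -> affine_lift N v *m invmx f != 0 /\
    pi (cinv psi v) = <[affine_lift N v *m invmx f]>%VS.
  move=> [pv _]; have [cv E] := cimageP ip pv; split; last by rewrite (pi_adapted cv) E.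
  apply: contraNneq (affine_lift_neq0 v) => E0.
  by rewrite -(mulmxKV fu (affine_lift N v)) E0 mul0mx.
rewrite (H psi Y _ hp oY Y1 Y2 Y3 Y4 u (conj pu Wu) j k).
rewrite (_ : (fun v => _) = fun v => (ln (sqnorm (affine_lift N v)))%:C).
  exact: dz_dzbar_potential.
by apply: funext => v; rewrite sqnorm_unitary.
Qed.

End Adapted.

Section Normal.
Local Open Scope ring_scope.
Variables (R : realType) (n : nat).
Notation C := R[i].
Notation V := 'rV[C]_n.

(** Quadratic vanishing, in the form used to compute first derivatives. *)
Lemma bigO_ray (F : V -> C) :
  F =O_ (nbhs (0 : V)) (fun u : V => `|u| ^+ 2) ->
  forall w : V, (s^-1)%:C * F (s%:C *: w) @[s --> (0 : R)^'+] --> (0 : C).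
Proof.
move=> /eqO_exP[k k0 Fk] w.
have L : s%:C * (k * `|w| ^+ 2) @[s --> (0 : R)^'+] --> (0 : C) * (k * `|w| ^+ 2).
  apply: cvgM; last exact: cvg_cst.
  apply: cvg_at_right_filter; exact: real_complex_continuous.
move: L; rewrite (mul0r (k * `|w| ^+ 2)) => L.
apply/(@cvgr0Pnorm_le C) => e e0; near=> s.
have s0 : 0 < s by near: s; exact: nbhs_right_gt.
have Fs : `|F (s%:C *: w)| <= k * `| `|s%:C *: w| ^+ 2|.
  near: s; exact: (cvg_at_right_filter (@cvg_ray0 R n w) Fk).
have Ls : `|s%:C * (k * `|w| ^+ 2)| <= e.
  by near: s; move/(@cvgr0Pnorm_le C) : L; apply.
have sC (r : R) : 0 < r -> `|r%:C| = r%:C by move=> r0; rewrite ger0_norm// ler0c ltW.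
have E : `|(s^-1)%:C| * (k * `| `|s%:C *: w| ^+ 2|) = `|s%:C * (k * `|w| ^+ 2)|.
  have w0 (u : V) : 0 <= `|u| ^+ 2 by rewrite exprn_ge0.
  have E1 : `| `|s%:C *: w| ^+ 2| = s%:C ^+ 2 * `|w| ^+ 2.
    by rewrite (ger0_norm (w0 _)) normrZ sC// exprMn.
  have E2 : `|s%:C * (k * `|w| ^+ 2)| = s%:C * (k * `|w| ^+ 2).
    apply: ger0_norm; apply: mulr_ge0; first by rewrite ler0c ltW.
    by apply: mulr_ge0; [exact: ltW|exact: w0].
  rewrite E1 E2 sC ?invr_gt0//.
  have : (s^-1)%:C * s%:C = 1 by rewrite -rmorphM /= mulVf// lt0r_neq0.
  move: (s^-1)%:C s%:C `|w| => x y r xy.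
  have -> : x * (k * (y ^+ 2 * r ^+ 2)) = (x * y) * (y * (k * r ^+ 2)) by ring.
  by rewrite xy mul1r.
apply: le_trans Ls; rewrite -E normrM; exact: ler_wpM2l.
Unshelve. all: by end_near. Qed.

Lemma mulmx_conj_entry (g A : 'M[C]_n) a b : (g *m A *m g ^t*) a b =
  \sum_c \sum_d g a c * (g b d)^* * A c d.
Proof.
rewrite mxE exchange_big; apply: eq_bigr => d _; rewrite !mxE mulr_suml; apply: eq_bigr => c _.
by rewrite mulrAC.
Qed.

Lemma mulmx_conj_sub1 (g A : 'M[C]_n) a b : g *m g ^t* = 1%:M ->
  (g *m A *m g ^t*) a b - (a == b)%:R =
  \sum_c \sum_d g a c * (g b d)^* * (A c d - (c == d)%:R).
Proof.
move=> gg; have -> : (a == b)%:R = (g *m 1%:M *m g ^t*) a b by rewrite mulmx1 gg mxE.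
rewrite !mulmx_conj_entry -sumrB; apply: eq_bigr => c _; rewrite -sumrB; apply: eq_bigr => d _.
by rewrite [(1%:M : 'M[C]_n) c d]mxE -mulrBr.
Qed.

(** A unitary change of coordinates preserves normality: H - 1 is the conjugate by
    f^-1 of the corresponding difference in the chart z. *)
Lemma normal_linear_chart (M : cmanifold R n) (h : sform M) (p : M)
    (z : chart R n M) (f : 'M[C]_n) :
    smooth_hermitian h -> normal_chart h p z -> f \is unitarymx ->
  let H := coef h (linear_chart z f) in
  [/\ forall a b, Ck 2 (cimage (linear_chart z f)) (fun x => H x a b),
      forall a b, H 0 a b = (a == b)%:R &
      forall a b v, rderive v (fun x => H x a b) 0 = 0].
Proof.
move=> [_ sm] [hz zp z0 zO] uf H; have fu := unitarymx_unit uf.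
have hl := holchart_linear fu hz; have [il _] := hl.
have H2 a b : Ck 2 (cimage (linear_chart z f)) (fun x => H x a b).
  by exact: (sm _ hl a b 2%N).
have l0 : cimage (linear_chart z f) 0 by exists p => //=; rewrite z0 mul0mx.
have EH x : cimage (linear_chart z f) x -> forall a b, H x a b - (a == b)%:R =
    \sum_c \sum_d invmx f a c * (invmx f b d)^* * (coef h z (x *m invmx f) c d - (c == d)%:R).
  move=> lx a b; rewrite /H coef_linear//; last first.
    by have [y zy <-] := lx; exists y => //=; rewrite mulmxK.
  exact: mulmx_conj_sub1 (invmx_is_unitary uf).
have cO c d : coef h z 0 c d - (c == d)%:R = 0.
  have /eqO_exP[k k0 /nbhs_singleton] := zO c d.
  by rewrite normr0 expr0n /= normr0 mulr0 normr_le0 => /eqP.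
have H0 a b : H 0 a b = (a == b)%:R.
  apply/eqP; rewrite -subr_eq0 (EH _ l0) big1// => c _; rewrite big1// => d _.
  by rewrite mul0mx cO mulr0.
split=> // a b v.
have A : (s^-1)%:C * (H (s%:C *: v) a b - (a == b)%:R) @[s --> (0 : R)^'+] -->
    rderive v (fun x => H x a b) 0.
  by rewrite -(H0 a b); exact: first_difference (Ck1_rderivable v (Ck2_Ck1 (H2 a b)) l0).
have B : \sum_c \sum_d invmx f a c * (invmx f b d)^* * ((s^-1)%:C *
    (coef h z (s%:C *: (v *m invmx f)) c d - (c == d)%:R)) @[s --> (0 : R)^'+] -->
   \sum_c \sum_d invmx f a c * (invmx f b d)^* * 0.
  apply: cvg_sum_complex => c; apply: cvg_sum_complex => d; apply: cvgM; first exact: cvg_cst.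
  exact: (bigO_ray (zO c d)).
rewrite [X in _ --> X]big1 in B; last by move=> c _; rewrite big1// => d _; rewrite mulr0.
apply: (cvg_near_unique _ A B); near=> s.
have ls : cimage (linear_chart z f) (s%:C *: v).
  near: s; have [_ ol _ _ _] := il.
  exact: (cvg_at_right_filter (@cvg_ray0 R n v) (open_nbhs_nbhs (conj ol l0))).
rewrite (EH _ ls) mulr_sumr.
apply: eq_bigr => c _; rewrite mulr_sumr.
apply: eq_bigr => d _.
rewrite mulrCA.
by rewrite (scalemxAl s%:C v (invmx f)).
Unshelve. all: by end_near. Qed.
End Normal.

(** * Tangent fields and contraction of the curvature tensor *)

Section TangentFields.
Local Open Scope ring_scope.
Variables (R : realType) (n : nat).
Notation C := R[i].
Notation V := 'rV[C]_n.+1.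
Notation N := (@ord_max n).
Variables (X Xhat : cmanifold R n.+1) (z : chart R n.+1 X) (mu : Xhat -> X)
  (pi : Xhat -> {vspace V}) (f : 'M[C]_n.+1) (q : Xhat) (psi : chart R n.+1 Xhat).
Hypothesis hinc : forall x, cdom z (mu x) -> \dim (pi x) = 1%N /\ z (mu x) \in pi x.
Hypothesis fu : f \in unitmx.
Hypothesis hpsi : adapted_chart z mu pi f q psi.

Let model (u : V) : 'rV[C]_(n.+1 + n) := row_mx (blowdown N u) (\row_i u 0 (lift N i)).

Lemma differentiable_model u : differentiable model u.
Proof.
apply: differentiable_rV => j; rewrite /model; case: (splitP j) => k jk.
  have -> : j = lshift n k by apply: val_inj.
  under eq_fun do rewrite row_mxEl; by have [] := is_diff_blowdown N u k.
have -> : j = rshift n.+1 k by apply: val_inj.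
under eq_fun do rewrite row_mxEr mxE; exact: differentiable_coord.
Qed.

Lemma diff_model0 (v : V) : 'd model 0 v 0 (lshift n N) = v 0 N /\
  forall i, 'd model 0 v 0 (rshift n.+1 i) = v 0 (lift N i).
Proof.
have dm := differentiable_model 0; split=> [|i]; rewrite (diff_rV _ _ dm) /model.
  under eq_fun do rewrite row_mxEl.
  by have [_ ->] := is_diff_blowdown N (0 : V) N; rewrite eqxx.
under eq_fun do rewrite row_mxEr mxE.
by have [_ ->] := is_diff_coord (0 : V) (lift N i).
Qed.

Lemma near_model u : cimage psi u -> \forall v \near u,
  row_mx (x_coord z mu f (cinv psi v)) (y_coord pi f (cinv psi v)) = model v.
Proof.
have [[ip _] _ _] := hpsi; move=> /(near_cimage ip); apply: filterS => v pv.
have [cv E] := cimageP ip pv; have [_ _ /(_ _ cv) [_ _ Hy _]] := hpsi.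
rewrite /x_coord (adapted_blowdown hinc fu hpsi cv) E; congr row_mx.
by apply/rowP => i; rewrite -Hy E mxE.
Qed.

(** At the origin both the differential of the embedding and the frame xi reduce
    to e_n in the last slot and to f_j in the others. *)
Lemma tangent_field0 (A alpha : V -> V) : cimage psi 0 ->
  tangent_field z mu pi f psi A alpha -> A 0 = alpha 0.
Proof.
move=> p0 /nbhs_singleton[_].
have E := nbhs_singleton (near_model p0).
have nE : \forall v \near (0 : V),
    model v = row_mx (x_coord z mu f (cinv psi v)) (y_coord pi f (cinv psi v)).
  by apply: filterS (near_model p0) => v ->.
rewrite (near_jacobian nE (differentiable_model 0)) mulmx_jacobian.
have [Ex Ey] := eq_row_mx E.
have -> : x_coord z mu f (cinv psi 0) = 0 by rewrite Ex /blowdown mxE scale0r.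
have -> : y_coord pi f (cinv psi 0) = 0 by rewrite Ey; apply/rowP => i; rewrite !mxE.
have [EN Ei] := diff_model0 (A 0).
have fN j : frame (0 : V) (0 : 'rV[C]_n) j 0 (lshift n N) = (j == N)%:R.
  rewrite /frame; case: unliftP => [i|] ->; rewrite row_mxEl !mxE.
    by rewrite mul0r (eq_sym _ N) (negPf (neq_lift _ _)).
  by rewrite summxE big1 ?add0r ?eqxx// => i _; rewrite !mxE mul0r.
have fi j i : frame (0 : V) (0 : 'rV[C]_n) j 0 (rshift n.+1 i) = (j == lift N i)%:R.
  rewrite /frame; case: unliftP => [k|] ->; rewrite row_mxEr !mxE.
    by rewrite (inj_eq (@lift_inj _ N)) eqxx eq_sym.
  by rewrite (negPf (neq_lift _ _)).
move=> H; apply/rowP => j; case: (unliftP N j) => [i|] ->.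
  rewrite -Ei H summxE -[RHS](sum_delta (lift N i) (fun j => alpha 0 0 j)).
  by apply: eq_bigr => k _; rewrite mxE fi eq_sym mulrC.
rewrite -EN H summxE -[RHS](sum_delta N (fun j => alpha 0 0 j)).
by apply: eq_bigr => k _; rewrite mxE fN eq_sym mulrC.
Qed.

End TangentFields.

Section Contraction.
Local Open Scope ring_scope.
Variables (R : realType) (n : nat).
Notation C := R[i].
Notation V := 'rV[C]_n.+1.
Notation N := (@ord_max n).
Implicit Types (X Y : 'I_n.+1 -> 'I_n.+1 -> C) (a b c d : V).

Definition contract X a b : C := \sum_j \sum_k X j k * (a 0 j * (b 0 k)^*).

Lemma contract4 X Y a b c d :
  \sum_j \sum_k \sum_l \sum_m X j k * Y l m * a 0 j * (b 0 k)^* * c 0 l * (d 0 m)^* =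
  contract X a b * contract Y c d.
Proof.
rewrite /contract mulr_suml; apply: eq_bigr => j _; rewrite mulr_suml; apply: eq_bigr => k _.
rewrite mulr_sumr; apply: eq_bigr => l _; rewrite mulr_sumr; apply: eq_bigr => m _.
by ring.
Qed.

Lemma contract4_swap X Y a b c d :
  \sum_j \sum_k \sum_l \sum_m X j m * Y l k * a 0 j * (b 0 k)^* * c 0 l * (d 0 m)^* =
  contract X a d * contract Y c b.
Proof.
rewrite -contract4; apply: eq_bigr => j _.
transitivity (\sum_l \sum_k \sum_m X j m * Y l k * a 0 j * (b 0 k)^* * c 0 l * (d 0 m)^*).
  exact: exchange_big.
transitivity (\sum_l \sum_m \sum_k X j m * Y l k * a 0 j * (b 0 k)^* * c 0 l * (d 0 m)^*).
  by apply: eq_bigr => l _; exact: exchange_big.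
rewrite exchange_big; apply: eq_bigr => m _; apply: eq_bigr => l _; apply: eq_bigr => k _.
by ring.
Qed.

Lemma contract_horizontal a b : contract (horizontal R N) a b = tau a b.
Proof.
rewrite /contract /tau big_ord_recr /= [X in _ + X]big1 ?addr0; last first.
  by move=> k _; rewrite /horizontal eqxx andbF mul0r.
apply: eq_bigr => i _; rewrite sum_horizontal.
have -> : widen_ord (leqnSn n) i = lift N i by apply: val_inj; rewrite /= /bump leqNgt ltn_ord.
by rewrite (eq_sym _ N) neq_lift mul1r.
Qed.

Lemma contract_last a b : contract (fun j k => (j == N)%:R * (k == N)%:R) a b = a 0 N * (b 0 N)^*.
Proof. by rewrite /contract sum_sep !sum_select. Qed.

(** The sum over four indices of each monomial in e and T factors into two sums
    over pairs of indices, which are a_N conj(b_N) for e e and tau for T. *)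
Lemma contract_curvature (Rm : 'I_n.+1 -> 'I_n.+1 -> 'I_n.+1 -> 'I_n.+1 -> C)
    (k0 t : C) a b c d :
    let e (j : 'I_n.+1) : C := (j == N)%:R in let T := horizontal R N in
    (forall j k l m, Rm j k l m =
      e j * e k * e l * e m * k0 + t * (T j k * T l m + T j m * T l k)
      - e j * e k * T l m - e j * e m * T l k - e l * e k * T j m - e l * e m * T j k) ->
  \sum_j \sum_k \sum_l \sum_m Rm j k l m * a 0 j * (b 0 k)^* * c 0 l * (d 0 m)^* =
  k0 * a 0 N * (b 0 N)^* * c 0 N * (d 0 N)^* + t * (tau a b * tau c d + tau a d * tau c b)
  - a 0 N * (b 0 N)^* * tau c d - a 0 N * (d 0 N)^* * tau c b
  - c 0 N * (b 0 N)^* * tau a d - c 0 N * (d 0 N)^* * tau a b.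
Proof.
move=> e T HR; pose E j k := e j * e k.
rewrite -!contract_horizontal.
transitivity (k0 * (contract E a b * contract E c d)
  + t * (contract T a b * contract T c d) + t * (contract T a d * contract T c b)
  - contract E a b * contract T c d - contract E a d * contract T c b
  - contract T a d * contract E c b - contract T a b * contract E c d); last first.
  by rewrite !contract_last; ring.
rewrite -(contract4 E E a b c d) -(contract4 T T a b c d) -(contract4_swap T T a b c d).
rewrite -(contract4 E T a b c d) -(contract4_swap E T a b c d).
rewrite -(contract4_swap T E a b c d) -(contract4 T E a b c d).
rewrite !mulr_sumr -!big_split /= -!sumrB; apply: eq_bigr => j _.
rewrite !mulr_sumr -!big_split /= -!sumrB; apply: eq_bigr => k _.
rewrite !mulr_sumr -!big_split /= -!sumrB; apply: eq_bigr => l _.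
rewrite !mulr_sumr -!big_split /= -!sumrB; apply: eq_bigr => m _.
by rewrite HR /E; ring.
Qed.

Lemma contract_delta (Rm : 'I_n.+1 -> 'I_n.+1 -> 'I_n.+1 -> 'I_n.+1 -> C)
    (N' : 'I_n.+1) :
  let v : V := delta_mx 0 N' in
  \sum_j \sum_k \sum_l \sum_m Rm j k l m * v 0 j * (v 0 k)^* * v 0 l * (v 0 m)^* =
  Rm N' N' N' N'.
Proof.
move=> v; have v1 : v 0 N' = 1 by rewrite mxE !eqxx.
have v0 j : j != N' -> v 0 j = 0 by move=> /negPf jN; rewrite mxE jN andbF.
rewrite (bigD1 N')//= [X in _ + X]big1 ?addr0 => [|j /v0 jN].
  rewrite (bigD1 N')//= [X in _ + X]big1 ?addr0 => [|j /v0 jN].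
    rewrite (bigD1 N')//= [X in _ + X]big1 ?addr0 => [|j /v0 jN].
      rewrite (bigD1 N')//= [X in _ + X]big1 ?addr0 => [|j /v0 jN].
        by rewrite v1 conjC1 !mulr1.
      by rewrite jN conjC0 mulr0.
    by rewrite big1// => k _; rewrite jN mulr0 mul0r.
  by rewrite big1// => k _; rewrite big1// => l _; rewrite jN conjC0 mulr0 !mul0r.
by rewrite big1// => k _; rewrite big1// => l _; rewrite big1// => m _; rewrite jN mulr0 !mul0r.
Qed.

End Contraction.

Section Assembly.
Local Open Scope ring_scope.
Variables (R : realType) (n : nat).
Notation C := R[i].
Notation V := 'rV[C]_n.+1.
Notation N := (@ord_max n).

Lemma Ck_subset m k (U W : set 'rV[C]_m) F : W `<=` U -> Ck k U F -> Ck k W F.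
Proof.
move=> WU; elim: k F => [|k IH] F [cF dF]; split.
- by move=> u /WU /cF.
- exact: I.
- by move=> u /WU /cF.
- move=> v; have [rF kF] := dF v; split; first by move=> u /WU /rF.
  exact: IH.
Qed.

Lemma coef_metric_t (X Xhat : cmanifold R n.+1) (mu : Xhat -> X) (h : sform X)
    (b : sform Xhat) (t : R) (c : chart R n.+1 Xhat) u l m :
  coef (metric_t mu h b t) c u l m = coef (pullback mu h) c u l m + t%:C * coef b c u l m.
Proof.
have E (J P B : 'M[C]_n.+1) (r : C) : (J *m (P + r *: B) *m J ^t*) l m =
    (J *m P *m J ^t*) l m + r * (J *m B *m J ^t*) l m.
  by rewrite mulmxDr mulmxDl -scalemxAr -scalemxAl mxE [X in _ + X]mxE.
exact: E.
Qed.

Lemma quad_delta (G : 'M[C]_n.+1) i :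
  ((delta_mx 0 i : V) *m G *m (delta_mx 0 i : V) ^t*) 0 0 = G i i.
Proof.
have E j : ((delta_mx 0 i : V) *m G) 0 j = G i j by rewrite -rowE mxE.
rewrite mxE (bigD1 i)//= [X in _ + X]big1 ?addr0 => [|j /negPf ji].
  by rewrite E !mxE !eqxx conjC1 mulr1.
by rewrite E !mxE ji andbF conjC0 mulr0.
Qed.

Lemma holo_sect_curv_normal (M : cmanifold R n.+1) (h : sform M)
    (c : chart R n.+1 M) (i : 'I_n.+1) :
  coef h c 0 i i = 1 ->
  holo_sect_curv h c 0 (delta_mx 0 i) = curv_coef (coef h c) 0 i i i i.
Proof.
move=> h1; rewrite /holo_sect_curv /curvature contract_delta.
rewrite (quad_delta (coef h c 0) i) h1.
by rewrite expr1n divr1.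
Qed.

End Assembly.

Unset Implicit Arguments.
Set Strict Implicit.

Theorem proposition2 (R : realType) (n : nat) (X Xhat : cmanifold R n.+1)
  (hX : compact [set: X])
  (h : sform X) (hK : kahler_metric h)
  (p : X) (z : chart R n.+1 X) (hz : normal_chart h p z)
  (mu : Xhat -> X) (pi : Xhat -> {vspace 'rV[R[i]]_n.+1})
  (hmu : is_blowup p z mu pi)
  (b : sform Xhat) (hb : is_form_b p z mu pi b)
  (t : R) (ht : 0 < t) (htK : kahler_metric (metric_t mu h b t))
  (q : Xhat) (hq : mu q = p)
  (w : 'rV[R[i]]_n.+1) (hw : pi q = <[w]>%VS)
  (f : 'M[R[i]]_n.+1) (hf : f \is unitarymx)
  (hfw : <[w *m f]>%VS = <[(delta_mx 0 ord_max)%R]>%VS)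
  (psi : chart R n.+1 Xhat) (hpsi : adapted_chart z mu pi f q psi)
  (A B C D alpha beta gamma delta : 'rV[R[i]]_n.+1 -> 'rV[R[i]]_n.+1)
  (hA : tangent_field z mu pi f psi A alpha)
  (hB : tangent_field z mu pi f psi B beta)
  (hC : tangent_field z mu pi f psi C gamma)
  (hD : tangent_field z mu pi f psi D delta) :
  let a := alpha 0 in let b' := beta 0 in
  let c := gamma 0 in let d := delta 0 in
  let N := @ord_max n in
  curvature (metric_t mu h b t) psi 0 (A 0) (B 0) (C 0) (D 0) =
    holo_sect_curv h (linear_chart z f) 0 (delta_mx 0 N)
      * a 0 N * (b' 0 N)^* * c 0 N * (d 0 N)^*
    + t%:C * (tau a b' * tau c d + tau a d * tau c b')
    - a 0 N * (b' 0 N)^* * tau c d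
    - a 0 N * (d 0 N)^* * tau c b'
    - c 0 N * (b' 0 N)^* * tau a d
    - c 0 N * (d 0 N)^* * tau a b'.

Proof.
move=> a b' c d N'.
have [_ hmap _ [hinc _ _]] := hmu.
have [hz' zp z0 _] := hz.
have fu := unitarymx_unit hf.
have [sh _ _] := hK.
have [H2 H0 dH] := normal_linear_chart sh hz hf.
have hl := holchart_linear fu hz'; have [il _] := hl.
have l0 : cimage (linear_chart z f) 0 by exists p => //=; rewrite z0 mul0mx.
have [hp dq Hp] := hpsi; have [ip _] := hp.
have psi0 : psi q = 0 := adapted_origin hpsi hq z0 hw hfw.
have p0 : cimage psi 0 by exists q.
have cq : cinv psi 0 = q by have [_ _ K _ _] := ip; rewrite -psi0 K.
rewrite (tangent_field0 hinc fu hpsi p0 hA) (tangent_field0 hinc fu hpsi p0 hB).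
rewrite (tangent_field0 hinc fu hpsi p0 hC) (tangent_field0 hinc fu hpsi p0 hD).
have [_ _ [W [oW Wp _ FS]]] := hb.
pose U := (cimage psi `&` [set v | W (cinv psi v)])%classic.
have oU : open U.
  rewrite openE => v [pv Wv]; apply: filterI; first exact: near_cimage.
  exact: near_cinv.
have U0 : U 0 by split=> //=; rewrite cq; apply: Wp.
have [[_ sG] _ _] := htK.
have G2 i j : Ck 2 U (fun x => coef (metric_t mu h b t) psi x i j).
  by apply: (Ck_subset (U := cimage psi)); [move=> v []|exact: (sG _ hp i j 2%N)].
have ol : open (cimage (linear_chart z f)) by have [] := il.
have GE u : U u -> forall l m, coef (metric_t mu h b t) psi u l m =
    pullback_coef ord_max (coef h (linear_chart z f)) u l m + t%:C * fubini_study_coef ord_max u l m.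
  move=> [pu Wu] l m.
  have [cu Eu] := cimageP ip pu; have [zu _ _ _] := Hp _ cu.
  rewrite coef_metric_t (coef_fubini_study hinc fu hpsi hf oW FS pu Wu); congr (_ + _).
  rewrite (coef_pullback h hmap hp hl pu zu (near_adapted hinc fu hpsi pu)
    (differentiable_blowdown _ u)).
  rewrite jacobian_blowdown mulmx_conj_entry /pullback_coef.
  by apply: eq_bigr => i _; apply: eq_bigr => j _; rewrite mulrAC.
have K := curv_coef_blowup oU U0 ol l0 G2 H2 H0 dH GE.
have HN : coef h (linear_chart z f) 0 ord_max ord_max = 1 by rewrite H0 eqxx.
have F := @contract_curvature R n (curv_coef (coef (metric_t mu h b t) psi) 0) _ _ a b' c d K.
rewrite (holo_sect_curv_normal HN).
exact: F.
Qed.
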